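(* Let $\mathcal C$ be a strict rigid category. The assignment $$\kappa\colon \mathrm{Pic}\,\mathsf A(\mathcal C)\to\mathrm{Piv}\,\mathsf Z(\mathcal C),\qquad [A]\mapsto\rho_A$$ is a (well-defined) morphism of heaps, and it induces a unique injective morphism of heaps $\iota\colon\mathrm{Pic}\,\mathsf A(\mathcal C)/\mathrm{Pic}\,\mathsf{SZ}(\mathcal C)\to\mathrm{Piv}\,\mathsf Z(\mathcal C)$ such that $\iota\circ\pi=\kappa$, where $\pi\colon\mathrm{Pic}\,\mathsf A(\mathcal C)\to\mathrm{Pic}\,\mathsf A(\mathcal C)/\mathrm{Pic}\,\mathsf{SZ}(\mathcal C)$ is the canonical projection.
   Context: Monoidal categories are strict. A rigid category (chosen left duals $X^\vee$ with $\mathrm{ev}^l_X\colon X^\vee\otimes X\to1$, $\mathrm{coev}^l_X\colon1\to X\otimes X^\vee$, and right duals) is strict rigid if left and right dualising $\mathcal C\to\mathcal C^{\mathrm{op},\otimes\text{-}\mathrm{op}}$ are strict monoidal and mutually inverse. An object is invertible if its left evaluation and coevaluation are isomorphisms. A heap is a set $G$ with a ternary operation $\langle-,-,-\rangle$ such that $\langle g,h,\langle i,j,k\rangle\rangle=\langle\langle g,h,i\rangle,j,k\rangle$ and $\langle g,g,h\rangle=h=\langle h,g,g\rangle$ (the empty set is allowed); morphisms are maps preserving the operation. $\mathsf Z(\mathcal C)$ is the Drinfeld centre: pairs $(X,\sigma_{X,-})$ with natural isomorphisms $\sigma_{X,Y}\colon X\otimes Y\to Y\otimes X$ satisfying $\sigma_{X,Y\otimes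 W}=(\mathrm{id}_Y\otimes\sigma_{X,W})(\sigma_{X,Y}\otimes\mathrm{id}_W)$, with $\sigma_{X\otimes X',Y}=(\sigma_{X,Y}\otimes\mathrm{id})(\mathrm{id}\otimes\sigma_{X',Y})$; it is rigid with duals lifted from $\mathcal C$. $\mathrm{Piv}\,\mathsf Z(\mathcal C)$ is the set of pivotal structures of $\mathsf Z(\mathcal C)$, i.e. monoidal natural isomorphisms $\mathrm{Id}_{\mathsf Z(\mathcal C)}\to(-)^{\vee\vee}$, a heap via $\langle\phi,\psi,\xi\rangle=\phi\psi^{-1}\xi$. $\mathsf A(\mathcal C)$ is the anti-Drinfeld centre: pairs $(A,\sigma_{A,-})$ with natural isomorphisms $\sigma_{A,Y}\colon A\otimes Y^{\vee\vee}\to Y\otimes A$ satisfying $\sigma_{A,Y\otimes W}=(\mathrm{id}_Y\otimes\sigma_{A,W})(\sigma_{A,Y}\otimes\mathrm{id}_{W^{\vee\vee}})$; morphisms commute with half-braidings. $A\in\mathsf A(\mathcal C)$ is $\mathcal C$-invertible if its underlying object is invertible in $\mathcal C$. For $A\in\mathsf A(\mathcal C)$ the left dual $A^\vee$ carries $\sigma_{A^\vee,Y}=(\mathrm{ev}^l_A\otimes\mathrm{id})(\mathrm{id}_{A^\vee}\otimes\sigma_{A,Y}^{-1}\otimes\mathrm{id}_{A^\vee})(\mathrm{id}\otimes\mathrm{coev}^l_A)\colon A^\vee\otimes Y\to Y^{\vee\vee}\otimes A^\vee$. $\mathrm{Pic}\,\mathsf A(\mathcal C)$ is the set of isomorphism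 classes of $\mathcal C$-invertible objects of $\mathsf A(\mathcal C)$, a heap via $\langle[A],[B],[C]\rangle=[A\otimes B^\vee\otimes C]$, with half-braiding obtained by composing $\sigma_{C,Y}\colon C\otimes Y^{\vee\vee}\to Y\otimes C$, $\sigma_{B^\vee,Y}$ and $\sigma_{A,Y}$ successively. For a $\mathcal C$-invertible $A=(\alpha,\sigma_{\alpha,-})\in\mathsf A(\mathcal C)$ and $X\in\mathsf Z(\mathcal C)$, $\rho_{A,X}\colon X\to X^{\vee\vee}$ is the composite $$X\xrightarrow{\mathrm{id}_X\otimes\mathrm{coev}^l_\alpha}X\otimes\alpha\otimes\alpha^\vee\xrightarrow{\sigma_{\alpha,X}^{-1}\otimes\mathrm{id}}\alpha\otimes X^{\vee\vee}\otimes\alpha^\vee\xrightarrow{\sigma_{X^{\vee\vee},\alpha}^{-1}\otimes\mathrm{id}}X^{\vee\vee}\otimes\alpha\otimes\alpha^\vee\xrightarrow{\mathrm{id}\otimes(\mathrm{coev}^l_\alpha)^{-1}}X^{\vee\vee}.$$ $\mathsf{SZ}(\mathcal C)\subseteq\mathsf Z(\mathcal C)$ is the symmetric centre: the full subcategory of objects $X$ with $\sigma_{X,Y}^{-1}=\sigma_{Y,X}$ for all $Y\in\mathsf Z(\mathcal C)$; it is rigid monoidal. $\mathrm{Pic}\,\mathsf{SZ}(\mathcal C)$ is the group of isomorphism classes of its invertible objects; it acts on $\mathrm{Pic}\,\mathsf A(\mathcal C)$ by $[B]\cdot[A]=[B\otimes A]$, with half-braiding $(\sigma_{B,Y}\otimes\mathrm{id}_A)(\mathrm{id}_B\otimes\sigma_{A,Y})$.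 $\mathrm{Pic}\,\mathsf A(\mathcal C)/\mathrm{Pic}\,\mathsf{SZ}(\mathcal C)$ is the set of orbits, with the heap structure making $\pi$ a morphism of heaps. *)

(* Defs.v *)
From mathcomp Require Import all_boot.
From mathcomp Require Import boolp.

Set Implicit Arguments.
Unset Strict Implicit.
Unset Printing Implicit Defensive.

Declare Scope moncat_scope.
Delimit Scope moncat_scope with M.
Local Open Scope moncat_scope.

(* A strict monoidal category, presented by its objects and its arrows, i.e.
   as a category internal to monoids: associativity and unitality of the
   tensor product are then plain equations.  Composition is a total function,
   but it is only specified on composable pairs; every definition below
   composes composable arrows only. *)
Record strict_monoidal : Type := StrictMonoidal {
  ob : Type;
  mor : Type;
  dom : mor -> ob;
  cod : mor -> ob;
  idm : ob -> mor;
  comp : mor -> mor -> mor; (* [comp g f] is g after f *)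
  one : ob;
  tens : ob -> ob -> ob;
  tensm : mor -> mor -> mor;
  dom_id : forall X, dom (idm X) = X;
  cod_id : forall X, cod (idm X) = X;
  dom_comp : forall g f, cod f = dom g -> dom (comp g f) = dom f;
  cod_comp : forall g f, cod f = dom g -> cod (comp g f) = cod g;
  comp_idl : forall f, comp (idm (cod f)) f = f;
  comp_idr : forall f, comp f (idm (dom f)) = f;
  compA : forall h g f, cod f = dom g -> cod g = dom h ->
    comp h (comp g f) = comp (comp h g) f;
  tensA : forall X Y Z, tens X (tens Y Z) = tens (tens X Y) Z;
  tens1l : forall X, tens one X = X;
  tens1r : forall X, tens X one = X;
  dom_tens : forall f g, dom (tensm f g) = tens (dom f) (dom g);
  cod_tens : forall f g, cod (tensm f g) = tens (cod f) (cod g);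
  tensmA : forall f g h, tensm f (tensm g h) = tensm (tensm f g) h;
  tensm1l : forall f, tensm (idm one) f = f;
  tensm1r : forall f, tensm f (idm one) = f;
  tens_id : forall X Y, tensm (idm X) (idm Y) = idm (tens X Y);
  tens_comp : forall g f g' f', cod f = dom g -> cod f' = dom g' ->
    tensm (comp g f) (comp g' f') = comp (tensm g g') (tensm f f')
}.

Arguments dom {s}. Arguments cod {s}. Arguments idm {s}.
Arguments comp {s}. Arguments one {s}.
Arguments tens {s}. Arguments tensm {s}.

Notation "g ∘ f" := (comp g f)
  (at level 50, left associativity) : moncat_scope.
Notation "X ⊗ Y" := (tens X Y) (at level 40, left associativity) : moncat_scope.
Notation "f ⊠ g" := (tensm f g) (at level 40, left associativity) : moncat_scope.
Notation "𝟙" := one : moncat_scope.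

Definition is_hom (C : strict_monoidal) (X Y : ob C) (f : mor C) : Prop :=
  dom f = X /\ cod f = Y.

Definition is_inverse (C : strict_monoidal) (f g : mor C) : Prop :=
  [/\ is_hom (cod f) (dom f) g, g ∘ f = idm (dom f) & f ∘ g = idm (cod f)].

Definition is_iso (C : strict_monoidal) (f : mor C) : Prop :=
  exists g, is_inverse f g.

(* The inverse of an isomorphism (and [f] itself if there is none). *)
Definition inv (C : strict_monoidal) (f : mor C) : mor C :=
  if pselect (is_iso f) is left p then projT1 (cid p) else f.

(* [ldual X] is X^∨ with its evaluation X^∨ ⊗ X -> 1 and its coevaluation
   1 -> X ⊗ X^∨; [rdual X] is the right dual, with evaluation
   X ⊗ (rdual X) -> 1 and coevaluation 1 -> (rdual X) ⊗ X. *)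
Record rigid : Type := Rigid {
  rigid_cat :> strict_monoidal;
  ldual : ob rigid_cat -> ob rigid_cat;
  lev : ob rigid_cat -> mor rigid_cat;
  lcoev : ob rigid_cat -> mor rigid_cat;
  rdual : ob rigid_cat -> ob rigid_cat;
  rev : ob rigid_cat -> mor rigid_cat;
  rcoev : ob rigid_cat -> mor rigid_cat;
  lev_hom : forall X, is_hom (ldual X ⊗ X) 𝟙 (lev X);
  lcoev_hom : forall X, is_hom 𝟙 (X ⊗ ldual X) (lcoev X);
  lsnake : forall X, (idm X ⊠ lev X) ∘ (lcoev X ⊠ idm X) = idm X;
  lsnake_dual : forall X,
    (lev X ⊠ idm (ldual X)) ∘ (idm (ldual X) ⊠ lcoev X) = idm (ldual X);
  rev_hom : forall X, is_hom (X ⊗ rdual X) 𝟙 (rev X);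
  rcoev_hom : forall X, is_hom 𝟙 (rdual X ⊗ X) (rcoev X);
  rsnake : forall X, (rev X ⊠ idm X) ∘ (idm X ⊠ rcoev X) = idm X;
  rsnake_dual : forall X,
    (idm (rdual X) ⊠ rev X) ∘ (rcoev X ⊠ idm (rdual X)) = idm (rdual X)
}.

Arguments ldual {r}. Arguments lev {r}. Arguments lcoev {r}.
Arguments rdual {r}. Arguments rev {r}. Arguments rcoev {r}.

Section DualisingFunctors.
Variable C : rigid.
Implicit Types (X Y : ob C) (f : mor C).

(* For f : X -> Y, the dual arrows Y^∨ -> X^∨ and (rdual Y) -> (rdual X). *)
Definition ldualm f : mor C :=
  (lev (cod f) ⊠ idm (ldual (dom f)))
  ∘ (idm (ldual (cod f)) ⊠ f ⊠ idm (ldual (dom f)))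
  ∘ (idm (ldual (cod f)) ⊠ lcoev (dom f)).

Definition rdualm f : mor C :=
  (idm (rdual (dom f)) ⊠ rev (cod f))
  ∘ (idm (rdual (dom f)) ⊠ f ⊠ idm (rdual (cod f)))
  ∘ (rcoev (dom f) ⊠ idm (rdual (cod f))).

(* The canonical monoidal structure of the dualising functors: the arrows
   Y^∨ ⊗ X^∨ -> (X ⊗ Y)^∨ and 1 -> 1^∨ induced by the universal property of
   the dual, and their right-handed versions. *)
Definition ldual_tens_comparison X Y : mor C :=
  ((lev Y ∘ (idm (ldual Y) ⊠ lev X ⊠ idm Y)) ⊠ idm (ldual (X ⊗ Y)))
  ∘ (idm (ldual Y ⊗ ldual X) ⊠ lcoev (X ⊗ Y)).

Definition rdual_tens_comparison X Y : mor C :=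
  (idm (rdual (X ⊗ Y)) ⊠ (rev X ∘ (idm X ⊠ rev Y ⊠ idm (rdual X))))
  ∘ (rcoev (X ⊗ Y) ⊠ idm (rdual Y ⊗ rdual X)).

Definition ldual_unit_comparison : mor C := lcoev 𝟙.
Definition rdual_unit_comparison : mor C := rcoev 𝟙.

End DualisingFunctors.

(* Both dualising functors C -> C^{op,⊗op} are strict monoidal, i.e. they
   preserve the tensor product and the unit on the nose and their canonical
   monoidal structure consists of identities; and they are mutually inverse. *)
Record strict_rigid : Type := StrictRigid {
  strict_rigid_cat :> rigid;
  ldual_one : ldual 𝟙 = 𝟙 :> ob strict_rigid_cat;
  ldual_tens : forall X Y : ob strict_rigid_cat,
    ldual (X ⊗ Y) = ldual Y ⊗ ldual X;
  ldualm_tens : forall f g : mor strict_rigid_cat,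
    ldualm (f ⊠ g) = ldualm g ⊠ ldualm f;
  ldual_unit_comparisonE : ldual_unit_comparison strict_rigid_cat = idm 𝟙;
  ldual_tens_comparisonE : forall X Y : ob strict_rigid_cat,
    ldual_tens_comparison X Y = idm (ldual (X ⊗ Y));
  rdual_one : rdual 𝟙 = 𝟙 :> ob strict_rigid_cat;
  rdual_tens : forall X Y : ob strict_rigid_cat,
    rdual (X ⊗ Y) = rdual Y ⊗ rdual X;
  rdualm_tens : forall f g : mor strict_rigid_cat,
    rdualm (f ⊠ g) = rdualm g ⊠ rdualm f;
  rdual_unit_comparisonE : rdual_unit_comparison strict_rigid_cat = idm 𝟙;
  rdual_tens_comparisonE : forall X Y : ob strict_rigid_cat,
    rdual_tens_comparison X Y = idm (rdual (X ⊗ Y));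
  rdual_ldual : forall X : ob strict_rigid_cat, rdual (ldual X) = X;
  ldual_rdual : forall X : ob strict_rigid_cat, ldual (rdual X) = X;
  rdualm_ldualm : forall f : mor strict_rigid_cat, rdualm (ldualm f) = f;
  ldualm_rdualm : forall f : mor strict_rigid_cat, ldualm (rdualm f) = f
}.

Definition invertible (C : rigid) (X : ob C) : Prop :=
  is_iso (lev X) /\ is_iso (lcoev X).

Lemma dom_lev (C : rigid) (X : ob C) : dom (lev X) = ldual X ⊗ X.
Proof. by case: (lev_hom X). Qed.
Lemma cod_lev (C : rigid) (X : ob C) : cod (lev X) = 𝟙.
Proof. by case: (lev_hom X). Qed.
Lemma dom_lcoev (C : rigid) (X : ob C) : dom (lcoev X) = 𝟙.
Proof. by case: (lcoev_hom X). Qed.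
Lemma cod_lcoev (C : rigid) (X : ob C) : cod (lcoev X) = X ⊗ ldual X.
Proof. by case: (lcoev_hom X). Qed.
Lemma dom_rev (C : rigid) (X : ob C) : dom (rev X) = X ⊗ rdual X.
Proof. by case: (rev_hom X). Qed.
Lemma cod_rev (C : rigid) (X : ob C) : cod (rev X) = 𝟙.
Proof. by case: (rev_hom X). Qed.
Lemma dom_rcoev (C : rigid) (X : ob C) : dom (rcoev X) = 𝟙.
Proof. by case: (rcoev_hom X). Qed.
Lemma cod_rcoev (C : rigid) (X : ob C) : cod (rcoev X) = rdual X ⊗ X.
Proof. by case: (rcoev_hom X). Qed.

Create HintDb ty.
#[global] Hint Rewrite dom_id cod_id dom_tens cod_tens dom_lev cod_lev dom_lcoev
  cod_lcoev dom_rev cod_rev dom_rcoev cod_rcoev : ty.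

(* [ty] solves side conditions such as [cod f = dom g]. *)
Ltac tynorm := autorewrite with ty; rewrite ?tensA ?tens1l ?tens1r.
Ltac ty :=
  repeat (autorewrite with ty;
    match goal with
    | H : dom ?f = _ |- context [dom ?f] => is_var f; rewrite H
    | H : cod ?f = _ |- context [cod ?f] => is_var f; rewrite H
    | H : is_hom _ _ ?f |- context [dom ?f] => rewrite (proj1 H)
    | H : is_hom _ _ ?f |- context [cod ?f] => rewrite (proj2 H)
    | H : forall _, dom _ = _ |- context [dom _] => rewrite H
    | H : forall _, cod _ = _ |- context [cod _] => rewrite H
    | |- context [dom (comp ?g ?f)] =>
      rewrite (@dom_comp _ g f); [| solve [ty]]
    | |- context [cod (comp ?g ?f)] =>
      rewrite (@cod_comp _ g f); [| solve [ty]]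
    end);
  tynorm; try done.

Section Basics.
Variable C : strict_monoidal.
Implicit Types (X Y : ob C) (f g h : mor C).

Lemma idl X f : cod f = X -> idm X ∘ f = f.
Proof. by move=> <-; exact: comp_idl. Qed.
Lemma idr X f : dom f = X -> f ∘ idm X = f.
Proof. by move=> <-; exact: comp_idr. Qed.

Lemma whl X g f : cod f = dom g -> idm X ⊠ (g ∘ f) = (idm X ⊠ g) ∘ (idm X ⊠ f).
Proof.
move=> e; rewrite -tens_comp //; last by ty.
by rewrite idl //; ty.
Qed.
Lemma whr X g f : cod f = dom g -> (g ∘ f) ⊠ idm X = (g ⊠ idm X) ∘ (f ⊠ idm X).
Proof.
move=> e; rewrite -tens_comp //; last by ty.
by rewrite idl //; ty.
Qed.

Lemma exchl X Y f g : cod f = X -> dom g = Y ->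
  (idm X ⊠ g) ∘ (f ⊠ idm Y) = f ⊠ g.
Proof. by move=> <- <-; rewrite -tens_comp ?comp_idl ?comp_idr //; ty. Qed.
Lemma exchr X Y f g : dom f = X -> cod g = Y ->
  (f ⊠ idm Y) ∘ (idm X ⊠ g) = f ⊠ g.
Proof. by move=> <- <-; rewrite -tens_comp ?comp_idl ?comp_idr //; ty. Qed.
Lemma exch X Y X' Y' f g : is_hom X X' f -> is_hom Y Y' g ->
  (idm X' ⊠ g) ∘ (f ⊠ idm Y) = (f ⊠ idm Y') ∘ (idm X ⊠ g).
Proof. by move=> [? ?] [? ?]; rewrite exchl // exchr. Qed.

Lemma inverse_uniq f g g' : is_inverse f g -> is_inverse f g' -> g = g'.
Proof.
move=> [[d c] gf fg] [[d' c'] g'f fg'].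
rewrite -(comp_idr g) d -fg' compA; [|ty|ty].
by rewrite gf idl.
Qed.
Lemma invP f : is_iso f -> is_inverse f (inv f).
Proof. by rewrite /inv => p; case: pselect => // q; case: cid. Qed.
Lemma inv_eq f g : is_inverse f g -> inv f = g.
Proof. by move=> p; apply: inverse_uniq (p); apply: invP; exists g. Qed.
Lemma is_inverse_sym f g : is_inverse f g -> is_inverse g f.
Proof. by move=> [[d c] gf fg]; split; rewrite ?d ?c. Qed.
Lemma is_iso_inv f : is_iso f -> is_iso (inv f).
Proof. by move=> /invP/is_inverse_sym ?; exists f. Qed.
Lemma dom_inv f : is_iso f -> dom (inv f) = cod f.
Proof. by move=> /invP[[]]. Qed.
Lemma cod_inv f : is_iso f -> cod (inv f) = dom f.
Proof. by move=> /invP[[]]. Qed.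
Lemma invl f : is_iso f -> inv f ∘ f = idm (dom f).
Proof. by move=> /invP[]. Qed.
Lemma invr f : is_iso f -> f ∘ inv f = idm (cod f).
Proof. by move=> /invP[]. Qed.
Lemma inverse_id X : is_inverse (idm X) (idm X).
Proof. by split; [split; ty|rewrite idl //; ty..]. Qed.
Lemma inverse_comp g f g' f' : cod f = dom g ->
  is_inverse f f' -> is_inverse g g' -> is_inverse (g ∘ f) (f' ∘ g').
Proof.
move=> e [[d c] e1 e2] [[d' c'] e3 e4]; split; first by split; ty.
- rewrite compA; [|ty|ty]. rewrite -(@compA _ f' g' g); [|ty|ty].
  rewrite e3 idr; [|ty]. by rewrite e1 dom_comp.
- rewrite compA; [|ty|ty]. rewrite -(@compA _ g f f'); [|ty|ty].
  rewrite e2 idr; [|ty]. by rewrite e4 cod_comp.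
Qed.
Lemma inverse_tens g f g' f' :
  is_inverse f f' -> is_inverse g g' -> is_inverse (f ⊠ g) (f' ⊠ g').
Proof.
move=> [[d c] e1 e2] [[d' c'] e3 e4]; split; first by split; ty.
- by rewrite -tens_comp ?e1 ?e3 ?tens_id; ty.
- by rewrite -tens_comp ?e2 ?e4 ?tens_id; ty.
Qed.
Lemma iso_id X : is_iso (idm X).
Proof. by exists (idm X); exact: inverse_id. Qed.
Lemma iso_comp g f : cod f = dom g -> is_iso f -> is_iso g -> is_iso (g ∘ f).
Proof. by move=> e [f' ?] [g' ?]; exists (f' ∘ g'); exact: inverse_comp. Qed.
Lemma iso_tens g f : is_iso f -> is_iso g -> is_iso (f ⊠ g).
Proof. by move=> [f' ?] [g' ?]; exists (f' ⊠ g'); exact: inverse_tens. Qed.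

End Basics.

Section Bend.
Variable C : rigid.
Implicit Types (P Q V X Y : ob C) (f g h : mor C).

Lemma bend_inj P Q V h h' : is_hom P (Q ⊗ ldual V) h -> is_hom P (Q ⊗ ldual V) h' ->
  (idm Q ⊠ lev V) ∘ (h ⊠ idm V) = (idm Q ⊠ lev V) ∘ (h' ⊠ idm V) -> h = h'.
Proof.
have E k : is_hom P (Q ⊗ ldual V) k ->
  k = (((idm Q ⊠ lev V) ∘ (k ⊠ idm V)) ⊠ idm (ldual V)) ∘ (idm P ⊠ lcoev V).
  move=> hk; rewrite whr; last by ty.
  rewrite -compA; [|ty|ty].
  have -> : k ⊠ idm V ⊠ idm (ldual V) ∘ (idm P ⊠ lcoev V)
     = (idm (Q ⊗ ldual V) ⊠ lcoev V) ∘ k.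
    rewrite -tensmA tens_id exchr; [|ty|ty].
    by rewrite -[k in RHS]tensm1r exchl //; ty.
  rewrite compA; [|ty|ty].
  rewrite -tens_id -!tensmA -whl; last by ty.
  by rewrite lsnake_dual tens_id idl //; ty.
by move=> hh hh' e; rewrite (E h) // (E h') // e.
Qed.

Lemma hom_ldualm X Y f : is_hom X Y f -> is_hom (ldual Y) (ldual X) (ldualm f).
Proof. by move=> hf; rewrite /ldualm; split; ty. Qed.
Lemma dom_ldualm f : dom (ldualm f) = ldual (cod f).
Proof. by case: (@hom_ldualm (dom f) (cod f) f). Qed.
Lemma cod_ldualm f : cod (ldualm f) = ldual (dom f).
Proof. by case: (@hom_ldualm (dom f) (cod f) f). Qed.

Lemma ldualmE X Y f : is_hom X Y f ->
  lev X ∘ (ldualm f ⊠ idm X) = lev Y ∘ (idm (ldual Y) ⊠ f).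
Proof.
move=> hf; rewrite /ldualm (proj1 hf) (proj2 hf).
rewrite whr; last by ty.
rewrite whr; last by ty.
rewrite -!tensmA !tens_id.
have -> : lev Y ⊠ idm (ldual X ⊗ X) ∘ (idm (ldual Y) ⊠ (f ⊠ idm (ldual X ⊗ X)))
   = (lev Y ∘ (idm (ldual Y) ⊠ f)) ⊠ idm (ldual X ⊗ X).
  by rewrite tensmA -whr; ty.
rewrite compA; [|ty|ty].
have -> : lev X ∘ ((lev Y ∘ (idm (ldual Y) ⊠ f)) ⊠ idm (ldual X ⊗ X)) =
   (lev Y ∘ (idm (ldual Y) ⊠ f)) ∘ (idm (ldual Y ⊗ X) ⊠ lev X).
  rewrite -[X in X ∘ _]tensm1l exchl; [|ty|ty].
  by rewrite -[X in _ = X ∘ _]tensm1r exchr //; ty.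
rewrite -compA; [|ty|ty].
rewrite -tens_id -tensmA -whl; last by ty.
by rewrite lsnake tens_id idr //; ty.
Qed.

Lemma ldualm_uniq X Y f h : is_hom X Y f -> is_hom (ldual Y) (ldual X) h ->
  lev X ∘ (h ⊠ idm X) = lev Y ∘ (idm (ldual Y) ⊠ f) -> h = ldualm f.
Proof.
move=> hf hh e; have hd := hom_ldualm hf.
apply: (@bend_inj (ldual Y) 𝟙 X); rewrite ?tens1l //.
by rewrite tensm1l e (ldualmE hf).
Qed.

Lemma ldualm_id X : ldualm (idm X) = idm (ldual X).
Proof. by symmetry; apply: (@ldualm_uniq X X); rewrite ?tens_id //; split; ty. Qed.

Lemma ldualm_comp g f : cod f = dom g -> ldualm (g ∘ f) = ldualm f ∘ ldualm g.
Proof.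
move=> e; symmetry.
have hf := @hom_ldualm (dom f) (dom g) f (conj erefl e).
have hg := @hom_ldualm (dom g) (cod g) g (conj erefl erefl).
apply: (@ldualm_uniq (dom f) (cod g)); [by split; ty|by split; ty|].
rewrite whr; last by ty.
rewrite compA; [|ty|ty].
rewrite (@ldualmE (dom f) (dom g)) //.
rewrite -compA; [|ty|ty].
rewrite (@exch _ (ldual (cod g)) (dom f) (ldual (dom g)) (dom g)) //.
rewrite compA; [|ty|ty].
rewrite (@ldualmE (dom g) (cod g)) //.
rewrite -compA; [|ty|ty].
by rewrite -whl.
Qed.

End Bend.
#[global] Hint Rewrite dom_ldualm cod_ldualm : ty.

Lemma levT (C : strict_rigid) (X Y : ob C) :
  lev (X ⊗ Y) = lev Y ∘ (idm (ldual Y) ⊠ lev X ⊠ idm Y).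
Proof.
have := ldual_tens_comparisonE X Y; rewrite /ldual_tens_comparison => e.
set g := lev Y ∘ _ in e *.
have hg : is_hom (ldual (X ⊗ Y) ⊗ (X ⊗ Y)) 𝟙 g.
  by rewrite /g ldual_tens; split; ty.
have : lev (X ⊗ Y) ∘ (idm (ldual (X ⊗ Y)) ⊠ idm (X ⊗ Y)) = lev (X ⊗ Y).
  by rewrite tens_id idr //; ty.
move=> <-; rewrite -e -ldual_tens.
rewrite whr; last by ty.
rewrite compA; [|ty|ty].
rewrite -!tensmA !tens_id.
have -> : lev (X ⊗ Y) ∘ (g ⊠ idm (ldual (X ⊗ Y) ⊗ (X ⊗ Y))) =
   g ∘ (idm (ldual (X ⊗ Y) ⊗ (X ⊗ Y)) ⊠ lev (X ⊗ Y)).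
  rewrite -[X in X ∘ _]tensm1l exchl; [|ty|ty].
  by rewrite -[X in _ = X ∘ _]tensm1r exchr //; ty.
rewrite -compA; [|ty|ty].
rewrite -tens_id -tensmA -whl; last by ty.
by rewrite lsnake tens_id idr //; ty.
Qed.

Lemma lcoev1 (C : strict_rigid) : lcoev 𝟙 = idm 𝟙 :> mor C.
Proof. exact: ldual_unit_comparisonE. Qed.

Lemma lev1 (C : strict_rigid) : lev 𝟙 = idm 𝟙 :> mor C.
Proof.
have := lsnake (𝟙 : ob C); rewrite tensm1l tensm1r lcoev1 idr //.
by ty; rewrite ldual_one; ty.
Qed.

Record smendo (C : strict_monoidal) : Type := SMEndo {
  fob : ob C -> ob C;
  fmor : mor C -> mor C;
  dom_fmor : forall f, dom (fmor f) = fob (dom f);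
  cod_fmor : forall f, cod (fmor f) = fob (cod f);
  fmor_id : forall X, fmor (idm X) = idm (fob X);
  fmor_comp : forall g f, cod f = dom g -> fmor (g ∘ f) = fmor g ∘ fmor f;
  fob_one : fob 𝟙 = 𝟙;
  fob_tens : forall X Y, fob (X ⊗ Y) = fob X ⊗ fob Y;
  fmor_tens : forall f g, fmor (f ⊠ g) = fmor f ⊠ fmor g
}.
#[global] Hint Rewrite dom_fmor cod_fmor fob_one fob_tens : ty.

Definition idF (C : strict_monoidal) : smendo C.
Proof. by exists id id. Defined.

Definition bidualF (C : strict_rigid) : smendo C.
Proof.
exists (fun X => ldual (ldual X)) (fun f => ldualm (ldualm f)).
- by move=> f; ty.
- by move=> f; ty.
- by move=> X; rewrite !ldualm_id.
- by move=> g f e; rewrite ldualm_comp // ldualm_comp //; ty; rewrite e.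
- by rewrite !ldual_one.
- by move=> X Y; rewrite !ldual_tens.
- by move=> f g; rewrite !ldualm_tens.
Defined.

(* Pairs (X, σ) with natural isomorphisms σ_Y : X ⊗ L Y -> R Y ⊗ X twisted by
   two strict monoidal endofunctors L and R.  Objects of Z(C) are the case
   L = R = Id, objects of A(C) the case L = (-)^∨∨ and R = Id; for A in A(C),
   the dual A^∨ is in the case L = Id and R = (-)^∨∨, so that A ⊗ B^∨ is in
   Z(C) and A ⊗ B^∨ ⊗ D is in A(C) again. *)
Record halfbraided (C : strict_monoidal) (L R : smendo C) : Type := HalfBraided {
  hob : ob C;
  hbr : ob C -> mor C;
  hbr_hom : forall Y, is_hom (hob ⊗ fob L Y) (fob R Y ⊗ hob) (hbr Y);
  hbr_iso : forall Y, is_iso (hbr Y);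
  hbr_nat : forall Y W f, is_hom Y W f ->
    (fmor R f ⊠ idm hob) ∘ hbr Y = hbr W ∘ (idm hob ⊠ fmor L f);
  hbr_tens : forall Y W,
    hbr (Y ⊗ W) = (idm (fob R Y) ⊠ hbr W) ∘ (hbr Y ⊠ idm (fob L W))
}.

Lemma dom_hbr (C : strict_monoidal) (L R : smendo C) (A : halfbraided L R) Y :
  dom (hbr A Y) = hob A ⊗ fob L Y.
Proof. by case: (hbr_hom A Y). Qed.
Lemma cod_hbr (C : strict_monoidal) (L R : smendo C) (A : halfbraided L R) Y :
  cod (hbr A Y) = fob R Y ⊗ hob A.
Proof. by case: (hbr_hom A Y). Qed.
Lemma dom_inv_hbr (C : strict_monoidal) (L R : smendo C) (A : halfbraided L R) Y :
  dom (inv (hbr A Y)) = fob R Y ⊗ hob A.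
Proof. by rewrite dom_inv ?cod_hbr //; exact: hbr_iso. Qed.
Lemma cod_inv_hbr (C : strict_monoidal) (L R : smendo C) (A : halfbraided L R) Y :
  cod (inv (hbr A Y)) = hob A ⊗ fob L Y.
Proof. by rewrite cod_inv ?dom_hbr //; exact: hbr_iso. Qed.
#[global] Hint Rewrite dom_hbr cod_hbr dom_inv_hbr cod_inv_hbr : ty.

Lemma halfbraided_eq (C : strict_monoidal) (L R : smendo C) (A B : halfbraided L R) :
  hob A = hob B -> (forall Y, hbr A Y = hbr B Y) -> A = B.
Proof.
case: A B => [X s h1 h2 h3 h4] [X' s' h1' h2' h3' h4'] /= e /funext e'.
move: h1 h2 h3 h4 h1' h2' h3' h4'; rewrite -e -e' => *.
by f_equal; exact: Prop_irrelevance.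
Qed.

Section HalfBraided.
Variables (C : strict_monoidal) (L R : smendo C).
Implicit Types (A B : halfbraided L R) (f g : mor C).

Definition hhom A B f : Prop :=
  is_hom (hob A) (hob B) f /\
  forall Y, (idm (fob R Y) ⊠ f) ∘ hbr A Y = hbr B Y ∘ (f ⊠ idm (fob L Y)).

Definition hiso A B f : Prop :=
  hhom A B f /\
  exists g, [/\ hhom B A g, g ∘ f = idm (hob A) & f ∘ g = idm (hob B)].

Definition hisomorphic A B : Prop := exists f, hiso A B f.

Lemma hhom_id A : hhom A A (idm (hob A)).
Proof.
split; first by split; ty.
by move=> Y; rewrite !tens_id idl ?idr //; ty.
Qed.

Lemma hhom_comp A B D g f : hhom A B f -> hhom B D g -> hhom A D (g ∘ f).
Proof.
move=> [hf ef] [hg eg]; have e : cod f = dom g by rewrite (proj1 hg) (proj2 hf).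
split; first by split; ty.
move=> Y; rewrite whl // whr // -compA; [|ty|ty].
rewrite ef compA; [|ty|ty].
by rewrite eg -compA //; ty.
Qed.

Lemma hiso_of_iso A B f : hhom A B f -> is_iso f -> hiso A B f.
Proof.
move=> hf /invP[]; have [[d c] ef] := hf; rewrite d c => -[d' c'] e1 e2.
split=> //; exists (inv f); split=> //; split=> // Y.
move: d' c' e1 e2; set g := inv f => d' c' e1 e2.
rewrite -[LHS](@idr _ (hob B ⊗ fob L Y)); last by ty.
have -> : idm (hob B ⊗ fob L Y) = (f ⊠ idm (fob L Y)) ∘ (g ⊠ idm (fob L Y)).
  by rewrite -whr ?e2 ?tens_id; ty.
rewrite -compA; [|ty|ty].
rewrite (@compA _ (hbr B Y)); [|ty|ty].
rewrite -ef compA; [|ty|ty].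
rewrite compA; [|ty|ty].
by rewrite -whl ?e1 ?tens_id ?idl //; ty.
Qed.

Lemma hiso_iso A B f : hiso A B f -> is_iso f.
Proof.
move=> [[[d c] _] [g [[h _] e1 e2]]]; exists g.
by split; rewrite ?d ?c.
Qed.

Lemma hiso_inv A B f : hiso A B f -> hiso B A (inv f).
Proof.
move=> [hf [g [hg e1 e2]]]; have [[d c] _] := hf.
have -> : inv f = g by apply: inv_eq; split; rewrite ?d ?c //; case: hg.
by split=> //; exists f.
Qed.

Lemma hisomorphic_refl A : hisomorphic A A.
Proof. by exists (idm (hob A)); apply: hiso_of_iso (hhom_id A) (iso_id _). Qed.
Lemma hisomorphic_sym A B : hisomorphic A B -> hisomorphic B A.
Proof. by move=> [f hf]; exists (inv f); exact: hiso_inv. Qed.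
Lemma hisomorphic_trans A B D :
  hisomorphic A B -> hisomorphic B D -> hisomorphic A D.
Proof.
move=> [f hf] [g hg]; exists (g ∘ f).
have [h1 _] := hf; have [h2 _] := hg.
apply: hiso_of_iso; first exact: hhom_comp h1 h2.
apply: iso_comp; [|exact: hiso_iso hf|exact: hiso_iso hg].
by case: h1 => -[_ ->]; case: h2 => -[-> _].
Qed.

Lemma hbr1 A : hbr A 𝟙 = idm (hob A).
Proof.
have := hbr_tens A 𝟙 𝟙; rewrite tens1l !fob_one tensm1l tensm1r => e.
have i := hbr_iso A 𝟙.
have : inv (hbr A 𝟙) ∘ hbr A 𝟙 = inv (hbr A 𝟙) ∘ (hbr A 𝟙 ∘ hbr A 𝟙) by rewrite -e.
rewrite compA; [|ty|ty].
by rewrite invl // idl => [<-|]; ty.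
Qed.

Lemma inv_hbr_nat A Y W f : is_hom Y W f ->
  inv (hbr A W) ∘ (fmor R f ⊠ idm (hob A)) = (idm (hob A) ⊠ fmor L f) ∘ inv (hbr A Y).
Proof.
move=> hf; have e := hbr_nat A hf.
have i := hbr_iso A Y; have j := hbr_iso A W.
rewrite -[LHS](@idr _ (fob R Y ⊗ hob A)); last by ty.
have -> : idm (fob R Y ⊗ hob A) = hbr A Y ∘ inv (hbr A Y) by rewrite invr //; ty.
rewrite -compA; [|ty|ty].
rewrite (@compA _ (_ ⊠ _)); [|ty|ty].
rewrite e -compA; [|ty|ty].
rewrite compA; [|ty|ty].
by rewrite invl // idl //; ty.
Qed.

Lemma inv_hbr_tens A Y W :
  inv (hbr A (Y ⊗ W)) = (inv (hbr A Y) ⊠ idm (fob L W)) ∘ (idm (fob R Y) ⊠ inv (hbr A W)).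
Proof.
apply: inv_eq; rewrite hbr_tens; apply: inverse_comp; first by ty.
- by apply: inverse_tens; [apply: invP; exact: hbr_iso|exact: inverse_id].
- by apply: inverse_tens; [exact: inverse_id|apply: invP; exact: hbr_iso].
Qed.

Lemma inv_hbr1 A : inv (hbr A 𝟙) = idm (hob A).
Proof. by apply: inv_eq; rewrite hbr1; exact: inverse_id. Qed.

End HalfBraided.

Section Tensor.
Variable C : strict_monoidal.

Definition hunit (F : smendo C) : halfbraided F F.
Proof.
exists 𝟙 (fun Y => idm (fob F Y)).
- by move=> Y; split; ty.
- by move=> Y; exact: iso_id.
- by move=> Y W f hf; rewrite tensm1l tensm1r idl ?idr //; ty.
- by move=> Y W; rewrite !tens_id idl //; ty.
Defined.

Definition htens (L M R : smendo C) (A : halfbraided M R) (B : halfbraided L M) :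
  halfbraided L R.
Proof.
exists (hob A ⊗ hob B)
  (fun Y => (hbr A Y ⊠ idm (hob B)) ∘ (idm (hob A) ⊠ hbr B Y)).
- by move=> Y; split; ty.
- move=> Y; apply: iso_comp; first by ty.
    by apply: iso_tens; [exact: iso_id|exact: hbr_iso].
  by apply: iso_tens; [exact: hbr_iso|exact: iso_id].
- move=> Y W f hf.
  rewrite compA; [|ty|ty].
  rewrite -tens_id tensmA -whr; last by ty.
  rewrite (hbr_nat A hf) whr; last by ty.
  rewrite -compA; [|ty|ty].
  rewrite -tensmA -whl; last by ty.
  rewrite (hbr_nat B hf) whl; last by ty.
  by rewrite compA ?tensmA ?tens_id; ty.
- move=> Y W; rewrite !hbr_tens.
  rewrite [in LHS]whr; last by ty.
  rewrite [in LHS]whl; last by ty.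
  rewrite [in RHS]whl; last by ty.
  rewrite [in RHS]whr; last by ty.
  rewrite -[in LHS]compA; [|ty|ty].
  rewrite -[in RHS]compA; [|ty|ty].
  rewrite !tensmA; congr (_ ∘ _).
  rewrite !compA; try by ty.
  congr (_ ∘ _).
  rewrite -!(tensmA (hbr A Y)) !tens_id.
  by symmetry; apply: exch; split; ty.
Defined.

End Tensor.

Section Dual.
Variable C : strict_rigid.

Section LaxIso.
Variables (L R : smendo C) (V : ob C) (t : ob C -> mor C).
Hypothesis t_hom : forall Y, is_hom (V ⊗ fob L Y) (fob R Y ⊗ V) (t Y).
Hypothesis t_nat : forall Y W f, is_hom Y W f ->
  (fmor R f ⊠ idm V) ∘ t Y = t W ∘ (idm V ⊠ fmor L f).
Hypothesis t_tens : forall Y W,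
  t (Y ⊗ W) = (idm (fob R Y) ⊠ t W) ∘ (t Y ⊠ idm (fob L W)).
Hypothesis t_one : t 𝟙 = idm V.

Let dom_t Y : dom (t Y) = V ⊗ fob L Y. Proof. by case: (t_hom Y). Qed.
Let cod_t Y : cod (t Y) = fob R Y ⊗ V. Proof. by case: (t_hom Y). Qed.
Hint Rewrite dom_t cod_t : ty.
Local Ltac tyt := ty.

Lemma lax_iso Y : is_iso (t Y).
Proof.
set Y' := rdual Y.
pose u1 := fmor R (rev Y) ⊠ idm (V ⊗ fob L Y).
pose u2 := idm (fob R Y) ⊠ t Y' ⊠ idm (fob L Y).
pose u3 := idm (fob R Y ⊗ V) ⊠ fmor L (rcoev Y).
have d1 : dom u1 = fob R Y ⊗ fob R Y' ⊗ V ⊗ fob L Y by rewrite /u1; tyt.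
have c1 : cod u1 = V ⊗ fob L Y by rewrite /u1; tyt.
have d2 : dom u2 = fob R Y ⊗ V ⊗ fob L Y' ⊗ fob L Y by rewrite /u2; tyt.
have c2 : cod u2 = fob R Y ⊗ fob R Y' ⊗ V ⊗ fob L Y by rewrite /u2; tyt.
have d3 : dom u3 = fob R Y ⊗ V by rewrite /u3; tyt.
have c3 : cod u3 = fob R Y ⊗ V ⊗ fob L Y' ⊗ fob L Y by rewrite /u3; tyt.
have hrev := rev_hom Y; have hrcoev := rcoev_hom Y; rewrite -/Y' in hrev hrcoev.
exists (u1 ∘ u2 ∘ u3); split; first by split; tyt.
- rewrite dom_t -compA; [|tyt|tyt].
  have -> : u3 ∘ t Y = (t Y ⊠ idm (fob L Y' ⊗ fob L Y))
       ∘ (idm (V ⊗ fob L Y) ⊠ fmor L (rcoev Y)).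
    rewrite exchr; [|tyt|tyt].
    by rewrite -{1}(tensm1r (t Y)) exchl; tyt.
  rewrite -compA; [|tyt|tyt].
  have -> : u2 ∘ ((t Y ⊠ idm (fob L Y' ⊗ fob L Y))
       ∘ (idm (V ⊗ fob L Y) ⊠ fmor L (rcoev Y))) =
     (t (Y ⊗ Y') ⊠ idm (fob L Y)) ∘ (idm (V ⊗ fob L Y) ⊠ fmor L (rcoev Y)).
    rewrite compA; [|tyt|tyt].
    congr (_ ∘ _); rewrite t_tens whr; last by tyt.
    by rewrite /u2 -[in LHS]tens_id !tensmA.
  rewrite compA; [|tyt|tyt].
  have -> : u1 ∘ (t (Y ⊗ Y') ⊠ idm (fob L Y)) = idm V ⊠ fmor L (rev Y) ⊠ idm (fob L Y).
    rewrite /u1 -tens_id tensmA -whr; last by tyt.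
    by rewrite (t_nat hrev) t_one idl; tyt.
  rewrite -tens_id -!tensmA -whl; last by tyt.
  by rewrite -!fmor_id -!fmor_tens -fmor_comp ?rsnake ?fmor_id ?tens_id //; tyt.
- rewrite cod_t compA; [|tyt|tyt].
  rewrite compA; [|tyt|tyt].
  have -> : t Y ∘ u1 = (fmor R (rev Y) ⊠ idm (fob R Y ⊗ V)) ∘ (idm (fob R Y ⊗ fob R Y') ⊠ t Y).
    rewrite exchr; [|tyt|tyt].
    by rewrite -{1}(tensm1l (t Y)) exchl; tyt.
  have -> : (fmor R (rev Y) ⊠ idm (fob R Y ⊗ V)) ∘ (idm (fob R Y ⊗ fob R Y') ⊠ t Y) ∘ u2
     = (fmor R (rev Y) ⊠ idm (fob R Y ⊗ V)) ∘ (idm (fob R Y) ⊠ t (Y' ⊗ Y)).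
    rewrite -compA; [|tyt|tyt].
    congr (_ ∘ _); rewrite t_tens whl; last by tyt.
    by rewrite /u2 -tens_id !tensmA.
  rewrite -compA; [|tyt|tyt].
  have -> : (idm (fob R Y) ⊠ t (Y' ⊗ Y)) ∘ u3 = idm (fob R Y) ⊠ fmor R (rcoev Y) ⊠ idm V.
    rewrite /u3 -tens_id -!tensmA -whl; last by tyt.
    by rewrite -(t_nat hrcoev) t_one idr; tyt.
  rewrite -tens_id tensmA -whr; last by tyt.
  by rewrite -!fmor_id -!fmor_tens -fmor_comp ?rsnake ?fmor_id ?tens_id //; tyt.
Qed.
End LaxIso.

Section Def.
Variables (L R : smendo C) (A : halfbraided L R).
Let V := hob A.
Let V' := ldual (hob A).

Definition hdual_br (Y : ob C) : mor C :=
  (lev (hob A) ⊠ idm (fob L Y ⊗ ldual (hob A)))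
  ∘ (idm (ldual (hob A)) ⊠ inv (hbr A Y) ⊠ idm (ldual (hob A)))
  ∘ (idm (ldual (hob A) ⊗ fob R Y) ⊠ lcoev (hob A)).

Lemma hdual_br_hom Y : is_hom (V' ⊗ fob R Y) (fob L Y ⊗ V') (hdual_br Y).
Proof. by rewrite /hdual_br /V'; split; ty. Qed.
Lemma dom_hdual_br Y : dom (hdual_br Y) = V' ⊗ fob R Y.
Proof. by case: (hdual_br_hom Y). Qed.
Lemma cod_hdual_br Y : cod (hdual_br Y) = fob L Y ⊗ V'.
Proof. by case: (hdual_br_hom Y). Qed.
Hint Rewrite dom_hdual_br cod_hdual_br : ty.
Local Ltac tyt := ty; rewrite /V' /V; ty.

Lemma hdual_brE Y : (idm (fob L Y) ⊠ lev V) ∘ (hdual_br Y ⊠ idm V)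
  = (lev V ⊠ idm (fob L Y)) ∘ (idm V' ⊠ inv (hbr A Y)).
Proof.
rewrite /hdual_br -/V -/V' whr; last by tyt.
rewrite whr; last by tyt.
rewrite -!tensmA !tens_id.
set k := inv (hbr A Y).
have hk : is_hom (fob R Y ⊗ V) (V ⊗ fob L Y) k by split; rewrite /k /V; ty.
have -> : lev V ⊠ idm (fob L Y ⊗ V' ⊗ V) ∘ (idm V' ⊠ (k ⊠ idm (V' ⊗ V)))
   = ((lev V ⊠ idm (fob L Y)) ∘ (idm V' ⊠ k)) ⊠ idm (V' ⊗ V).
  rewrite whr; last by tyt.
  by rewrite -!tensmA !tens_id tensA.
rewrite compA; [|tyt|tyt].
set m := (lev V ⊠ idm (fob L Y)) ∘ (idm V' ⊠ k).
have hm : is_hom (V' ⊗ fob R Y ⊗ V) (fob L Y) m by rewrite /m; split; tyt.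
have -> : (idm (fob L Y) ⊠ lev V) ∘ (m ⊠ idm (V' ⊗ V)) =
   m ∘ (idm (V' ⊗ fob R Y ⊗ V) ⊠ lev V).
  rewrite exchl; [|tyt|tyt].
  by rewrite -[X in _ = X ∘ _]tensm1r exchr //; tyt.
rewrite -compA; [|tyt|tyt].
rewrite -tens_id -tensmA -whl; last by tyt.
by rewrite lsnake tens_id idr //; tyt.
Qed.

Lemma hdual_br_uniq Y h : is_hom (V' ⊗ fob R Y) (fob L Y ⊗ V') h ->
  (idm (fob L Y) ⊠ lev V) ∘ (h ⊠ idm V)
  = (lev V ⊠ idm (fob L Y)) ∘ (idm V' ⊠ inv (hbr A Y)) -> h = hdual_br Y.
Proof.
by move=> hh e; apply: bend_inj hh (hdual_br_hom Y) _; rewrite -/V hdual_brE.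
Qed.

Lemma hdual_br_nat Y W f : is_hom Y W f ->
  (fmor L f ⊠ idm V') ∘ hdual_br Y = hdual_br W ∘ (idm V' ⊠ fmor R f).
Proof.
move=> hf; apply: (@bend_inj _ (V' ⊗ fob R Y) (fob L W) V); [by split; tyt..|].
rewrite whr; last by tyt.
rewrite compA; [|tyt|tyt].
rewrite -tensmA tens_id exchl; [|tyt|tyt].
have -> : fmor L f ⊠ lev V = fmor L f ∘ (idm (fob L Y) ⊠ lev V).
  by rewrite -[X in _ = X ∘ _]tensm1r exchr //; tyt.
rewrite -compA; [|tyt|tyt].
rewrite hdual_brE.
rewrite [in RHS]whr; last by tyt.
rewrite [in RHS]compA; [|tyt|tyt].
rewrite hdual_brE -[in RHS]compA; [|tyt|tyt].
rewrite -tensmA -whl; last by tyt.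
rewrite (inv_hbr_nat A hf) whl; last by tyt.
rewrite !compA; [|tyt..].
congr (_ ∘ _).
rewrite tensmA tens_id exchr; [|tyt|tyt].
by rewrite -[X in X ∘ _]tensm1l exchl //; tyt.
Qed.

Lemma hdual_br_tens Y W :
  hdual_br (Y ⊗ W) = (idm (fob L Y) ⊠ hdual_br W) ∘ (hdual_br Y ⊠ idm (fob R W)).
Proof.
symmetry; apply: hdual_br_uniq; first by split; tyt.
rewrite whr; last by tyt.
rewrite compA; [|tyt|tyt].
rewrite fob_tens -tens_id -!tensmA -whl; last by tyt.
rewrite hdual_brE whl; last by tyt.
rewrite -compA; [|tyt|tyt].
have -> : (idm (fob L Y) ⊠ (idm V' ⊠ inv (hbr A W))) ∘ (hdual_br Y ⊠ (idm (fob R W) ⊠ idm V))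
   = (hdual_br Y ⊠ idm (V ⊗ fob L W)) ∘ (idm (V' ⊗ fob R Y) ⊠ inv (hbr A W)).
  rewrite !tensmA !tens_id -tensmA tens_id.
  by apply: exch; split; tyt.
rewrite compA; [|tyt|tyt].
have -> : idm (fob L Y) ⊠ (lev V ⊠ idm (fob L W)) ∘ hdual_br Y ⊠ idm (V ⊗ fob L W)
   = ((lev V ⊠ idm (fob L Y)) ∘ (idm V' ⊠ inv (hbr A Y))) ⊠ idm (fob L W).
  by rewrite -hdual_brE whr -?tens_id ?tensmA //; tyt.
rewrite whr; last by tyt.
rewrite -compA; [|tyt|tyt].
rewrite inv_hbr_tens whl; last by tyt.
by rewrite -!tens_id -!tensmA.
Qed.

Lemma hdual_br1 : hdual_br 𝟙 = idm V'.
Proof.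
symmetry; apply: hdual_br_uniq; first by split; tyt.
by rewrite inv_hbr1 !fob_one !tensm1l !tensm1r tens_id.
Qed.

Definition hdual : halfbraided R L.
Proof.
exists (ldual (hob A)) hdual_br.
- exact: hdual_br_hom.
- apply: lax_iso.
  + exact: hdual_br_hom.
  + exact: hdual_br_nat.
  + exact: hdual_br_tens.
  + exact: hdual_br1.
- exact: hdual_br_nat.
- exact: hdual_br_tens.
Defined.

End Def.
End Dual.

Lemma hdual_hbrE (C : strict_rigid) (L R : smendo C) (A : halfbraided L R) Y :
  (idm (fob L Y) ⊠ lev (hob A)) ∘ (hbr (hdual A) Y ⊠ idm (hob A))
  = (lev (hob A) ⊠ idm (fob L Y)) ∘ (idm (ldual (hob A)) ⊠ inv (hbr A Y)).
Proof. exact: hdual_brE. Qed.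

Lemma hob_htens (C : strict_monoidal) (L M R : smendo C)
  (A : halfbraided M R) (B : halfbraided L M) : hob (htens A B) = hob A ⊗ hob B.
Proof. by []. Qed.
Lemma hob_hdual (C : strict_rigid) (L R : smendo C) (A : halfbraided L R) :
  hob (hdual A) = ldual (hob A).
Proof. by []. Qed.
Lemma hob_hunit (C : strict_monoidal) (F : smendo C) : hob (hunit F) = 𝟙.
Proof. by []. Qed.
#[global] Hint Rewrite hob_htens hob_hdual hob_hunit : ty.

Lemma hbr_htens (C : strict_monoidal) (L M R : smendo C)
  (A : halfbraided M R) (B : halfbraided L M) Y :
  hbr (htens A B) Y = (hbr A Y ⊠ idm (hob B)) ∘ (idm (hob A) ⊠ hbr B Y).
Proof. by []. Qed.
Lemma hbr_hunit (C : strict_monoidal) (F : smendo C) Y : hbr (hunit F) Y = idm (fob F Y).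
Proof. by []. Qed.

Section TensorFacts.
Variable C : strict_monoidal.

Lemma htensA (F G H K : smendo C) (A : halfbraided H K) (B : halfbraided G H)
  (D : halfbraided F G) : htens A (htens B D) = htens (htens A B) D.
Proof.
apply: halfbraided_eq; first by rewrite /= tensA.
move=> Y; rewrite !hbr_htens !hob_htens.
rewrite whl; last by ty.
rewrite whr; last by ty.
by rewrite -!tens_id !tensmA compA; ty.
Qed.

Lemma htens1l (L R : smendo C) (A : halfbraided L R) : htens (hunit R) A = A.
Proof.
apply: halfbraided_eq; first by rewrite /= tens1l.
by move=> Y; rewrite !hbr_htens hbr_hunit hob_hunit tensm1l tens_id idl //; ty.
Qed.

Lemma htens1r (L R : smendo C) (A : halfbraided L R) : htens A (hunit L) = A.
Proof.
apply: halfbraided_eq; first by rewrite /= tens1r.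
by move=> Y; rewrite !hbr_htens hbr_hunit hob_hunit tensm1r tens_id idr //; ty.
Qed.

Lemma hhom_htens (L M R : smendo C) (A A' : halfbraided M R) (B B' : halfbraided L M) f g :
  hhom A A' f -> hhom B B' g -> hhom (htens A B) (htens A' B') (f ⊠ g).
Proof.
move=> [hf ef] [hg eg]; split; first by split; ty.
move=> Y; rewrite !hbr_htens.
rewrite -[f ⊠ g](@exchl _ (hob A') (hob B)); [|ty|ty].
rewrite [in LHS]whl; last by ty.
rewrite !compA; [|ty..].
rewrite -(@compA _ (_ ⊠ (_ ⊠ g))); [|ty|ty].
rewrite (tensmA _ f) -whr; last by ty.
rewrite ef whr; last by ty.
rewrite compA; [|ty|ty].
have -> : (idm (fob R Y) ⊠ (idm (hob A') ⊠ g)) ∘ (hbr A' Y ⊠ idm (hob B)) =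
   (hbr A' Y ⊠ idm (hob B')) ∘ (idm (hob A') ⊠ (idm (fob M Y) ⊠ g)).
  by rewrite !tensmA !tens_id; apply: exch => //; split; ty.
rewrite -!compA; [|ty..].
have -> : (f ⊠ idm (fob M Y) ⊠ idm (hob B)) ∘ (idm (hob A) ⊠ hbr B Y) =
   (idm (hob A') ⊠ hbr B Y) ∘ (f ⊠ idm (hob B ⊗ fob L Y)).
  by rewrite -tensmA tens_id; symmetry; apply: exch => //; split; ty.
rewrite (@compA _ (_ ⊠ (_ ⊠ g))); [|ty|ty].
rewrite -whl; last by ty.
rewrite eg whl; last by ty.
rewrite -!compA; [|ty..].
congr (_ ∘ (_ ∘ _)).
by rewrite tensmA -tens_id tensmA -whr; ty.
Qed.

Lemma hiso_htens (L M R : smendo C) (A A' : halfbraided M R) (B B' : halfbraided L M) :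
  hisomorphic A A' -> hisomorphic B B' -> hisomorphic (htens A B) (htens A' B').
Proof.
move=> [f hf] [g hg]; exists (f ⊠ g); apply: hiso_of_iso.
  by apply: hhom_htens; [case: hf|case: hg].
by apply: iso_tens; [apply: hiso_iso hf|apply: hiso_iso hg].
Qed.

End TensorFacts.

Section DualFacts.
Variable C : strict_rigid.

Lemma hhom_ldualm (L R : smendo C) (A B : halfbraided L R) f :
  hhom A B f -> hhom (hdual B) (hdual A) (ldualm f).
Proof.
move=> hhf; have [hf ef] := hhf; have hd := hom_ldualm hf.
have iA Y := hbr_iso A Y; have iB Y := hbr_iso B Y.
have ef' Y : inv (hbr B Y) ∘ (idm (fob R Y) ⊠ f) = (f ⊠ idm (fob L Y)) ∘ inv (hbr A Y).
  rewrite -[LHS](@idr _ (fob R Y ⊗ hob A)); last by ty.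
  have -> : idm (fob R Y ⊗ hob A) = hbr A Y ∘ inv (hbr A Y) by rewrite invr //; ty.
  rewrite -compA; [|ty|ty].
  rewrite (@compA _ (_ ⊠ _)); [|ty|ty].
  rewrite ef -compA; [|ty|ty].
  rewrite compA; [|ty|ty].
  by rewrite invl // idl //; ty.
split=> // Y.
apply: (@bend_inj _ (ldual (hob B) ⊗ fob R Y) (fob L Y) (hob A)); [by split; ty..|].
rewrite whr; last by ty.
rewrite compA; [|ty|ty].
rewrite -tensmA -whl; last by ty.
rewrite (ldualmE hf) whl; last by ty.
rewrite -compA; [|ty|ty].
have -> : (idm (fob L Y) ⊠ (idm (ldual (hob B)) ⊠ f)) ∘ (hbr (hdual B) Y ⊠ idm (hob A))
   = (hbr (hdual B) Y ⊠ idm (hob B)) ∘ (idm (ldual (hob B) ⊗ fob R Y) ⊠ f).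
  by rewrite tensmA tens_id; apply: exch => //; split; ty.
rewrite compA; [|ty|ty].
rewrite hdual_hbrE -compA; [|ty|ty].
rewrite -tens_id -tensmA -whl; last by ty.
rewrite ef' whl; last by ty.
rewrite [in RHS]whr; last by ty.
rewrite [in RHS]compA; [|ty|ty].
rewrite hdual_hbrE -[in RHS]compA; [|ty|ty].
rewrite compA; [|ty|ty].
have -> : (idm (ldual (hob A)) ⊠ inv (hbr A Y)) ∘ (ldualm f ⊠ idm (fob R Y) ⊠ idm (hob A))
  = (ldualm f ⊠ idm (hob A ⊗ fob L Y)) ∘ (idm (ldual (hob B)) ⊠ inv (hbr A Y)).
  by rewrite -tensmA tens_id; apply: exch => //; split; ty.
rewrite compA; [|ty|ty].
congr (_ ∘ _).
by rewrite -tens_id !tensmA -!whr ?(ldualmE hf) //; ty.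
Qed.

Lemma inverse_ldualm (f g : mor C) : is_inverse f g -> is_inverse (ldualm f) (ldualm g).
Proof.
move=> [[d c] e1 e2]; split; first by split; ty.
- by rewrite -ldualm_comp ?e2 ?ldualm_id //; ty.
- by rewrite -ldualm_comp ?e1 ?ldualm_id //; ty.
Qed.
Lemma iso_ldualm (f : mor C) : is_iso f -> is_iso (ldualm f).
Proof. by move=> [g h]; exists (ldualm g); exact: inverse_ldualm. Qed.

Lemma hiso_hdual (L R : smendo C) (A B : halfbraided L R) :
  hisomorphic A B -> hisomorphic (hdual A) (hdual B).
Proof.
move=> h; apply: hisomorphic_sym; have [f hf] := h; exists (ldualm f).
apply: hiso_of_iso; first by apply: hhom_ldualm; case: hf.
by apply: iso_ldualm; apply: hiso_iso hf.
Qed.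

Lemma hhom_lev (L R : smendo C) (A : halfbraided L R) :
  hhom (htens (hdual A) A) (hunit L) (lev (hob A)).
Proof.
split; first by split; ty.
move=> Y; rewrite hbr_htens hbr_hunit compA; [|ty|ty].
rewrite hdual_hbrE -compA; [|ty|ty].
rewrite -whl; last by ty.
by rewrite invl ?tens_id ?idr ?idl //; ty; apply: hbr_iso.
Qed.

Lemma hdual_htens (L M R : smendo C) (A : halfbraided M R) (B : halfbraided L M) :
  hdual (htens A B) = htens (hdual B) (hdual A).
Proof.
apply: halfbraided_eq; first by rewrite /= ldual_tens.
move=> Y; symmetry; apply: hdual_br_uniq.
  by rewrite hob_htens ldual_tens; split; ty.
have e : inv (hbr (htens A B) Y)
    = (idm (hob A) ⊠ inv (hbr B Y)) ∘ (inv (hbr A Y) ⊠ idm (hob B)).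
  apply: inv_eq; rewrite hbr_htens; apply: inverse_comp; first by ty.
  - by apply: inverse_tens; [exact: inverse_id|apply: invP; exact: hbr_iso].
  - by apply: inverse_tens; [apply: invP; exact: hbr_iso|exact: inverse_id].
rewrite e hob_htens ldual_tens hbr_htens !hob_hdual levT.
rewrite [in LHS](@whr _ _ (hbr (hdual B) Y ⊠ idm (ldual (hob A)))); last by ty.
rewrite -!tens_id.
rewrite [in LHS]whl; last by ty.
rewrite -compA; [|ty..].
rewrite (@compA _ (_ ⊠ (_ ⊠ _ ⊠ _))); [|ty..].
have -> : (idm (fob L Y) ⊠ (idm (ldual (hob B)) ⊠ lev (hob A) ⊠ idm (hob B)))
     ∘ (hbr (hdual B) Y ⊠ idm (ldual (hob A)) ⊠ (idm (hob A) ⊠ idm (hob B)))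
   = (hbr (hdual B) Y ⊠ idm (hob B)) ∘ (idm (ldual (hob B) ⊗ fob M Y) ⊠ lev (hob A) ⊠ idm (hob B)).
  rewrite !tensmA -!whr; [|ty..].
  congr (_ ⊠ _); rewrite tens_id -tensmA tens_id.
  rewrite exchl; [|ty..].
  by rewrite -{2}(tensm1r (hbr _ _)) exchr; ty.
rewrite !compA; [|ty..].
rewrite hdual_hbrE -!compA; [|ty..].
rewrite [in RHS]whr; last by ty.
rewrite -[in RHS]compA; [|ty..].
congr (_ ∘ _).
have -> : (idm (ldual (hob B) ⊗ fob M Y) ⊠ lev (hob A) ⊠ idm (hob B))
     ∘ (idm (ldual (hob B)) ⊠ hbr (hdual A) Y ⊠ (idm (hob A) ⊠ idm (hob B)))
   = (idm (ldual (hob B)) ⊠ lev (hob A) ⊠ idm (fob M Y) ⊠ idm (hob B))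
     ∘ (idm (ldual (hob B)) ⊠ idm (ldual (hob A)) ⊠ inv (hbr A Y) ⊠ idm (hob B)).
  rewrite !tensmA -!whr; [|ty..].
  congr (_ ⊠ _); rewrite -tens_id -!tensmA -!whl; [|ty..].
  by congr (_ ⊠ _); exact: hdual_hbrE.
rewrite !compA; [|ty..].
rewrite [in RHS]tens_id whl; last by ty.
rewrite -tens_id !tensmA !compA; [|ty..].
congr (_ ∘ _).
rewrite -!(tensmA (_ ⊠ lev (hob A))) !tens_id.
by apply: exch; split; ty.
Qed.

End DualFacts.

Lemma hhom_lcoev (C : strict_rigid) (L R : smendo C) (A : halfbraided L R) :
  hhom (hunit R) (htens A (hdual A)) (lcoev (hob A)).
Proof.
split; first by split; ty.
move=> Y; rewrite hbr_htens hbr_hunit hob_hdual.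
apply: (@bend_inj _ (fob R Y) (fob R Y ⊗ hob A) (hob A)); [by split; ty..|].
transitivity (idm (fob R Y ⊗ hob A)).
  rewrite idr; last by ty.
  by rewrite -tens_id -!tensmA -whl ?lsnake //; ty.
symmetry.
rewrite !whr; [|ty..].
rewrite !compA; [|ty..].
have -> : (idm (fob R Y ⊗ hob A) ⊠ lev (hob A))
    ∘ (hbr A Y ⊠ idm (ldual (hob A)) ⊠ idm (hob A))
  = hbr A Y ∘ (idm (hob A ⊗ fob L Y) ⊠ lev (hob A)).
  rewrite -tensmA tens_id exchl; [|ty..].
  by rewrite -{2}(tensm1r (hbr A Y)) exchr; ty.
have -> : hbr A Y ∘ (idm (hob A ⊗ fob L Y) ⊠ lev (hob A))
    ∘ (idm (hob A) ⊠ hbr (hdual A) Y ⊠ idm (hob A))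
  = hbr A Y ∘ (idm (hob A) ⊠ lev (hob A) ⊠ idm (fob L Y))
    ∘ (idm (hob A) ⊠ idm (ldual (hob A)) ⊠ inv (hbr A Y)).
  rewrite -!compA; [|ty..]; congr (_ ∘ _).
  rewrite -tens_id -!tensmA -!whl; [|ty..].
  by congr (_ ⊠ _); exact: hdual_hbrE.
rewrite -compA; [|ty..].
have -> : (idm (hob A) ⊠ idm (ldual (hob A)) ⊠ inv (hbr A Y))
    ∘ (lcoev (hob A) ⊠ idm (fob R Y) ⊠ idm (hob A))
  = (lcoev (hob A) ⊠ idm (hob A ⊗ fob L Y)) ∘ inv (hbr A Y).
  rewrite !tens_id -(tensmA (lcoev _)) !tens_id exchl; [|ty..].
  by rewrite -{2}(tensm1l (inv (hbr A Y))) exchr; ty.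
rewrite -compA; [|ty..].
rewrite (@compA _ _ (lcoev (hob A) ⊠ idm (hob A ⊗ fob L Y))); [|ty..].
rewrite -tens_id tensmA -whr; last by ty.
rewrite lsnake tens_id idl; last by ty.
by rewrite invr; [ty|exact: hbr_iso].
Qed.

Section Invertible.
Variable C : strict_rigid.
Implicit Types X Y : ob C.

Lemma lcoevT X Y :
  lcoev (X ⊗ Y) = (idm X ⊠ lcoev Y ⊠ idm (ldual X)) ∘ lcoev X.
Proof.
have e := ldual_tens X Y.
apply: (@bend_inj _ 𝟙 (X ⊗ Y) (X ⊗ Y)); [by split; ty; rewrite ?e; ty..|].
rewrite lsnake levT; symmetry.
rewrite whl; last by ty.
rewrite [X in _ ∘ X]whr; last by ty.
rewrite !compA; [|ty..].
rewrite -(@compA _ _ (idm (X ⊗ Y) ⊠ (_ ⊠ lev X ⊠ _))); [|ty..].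
have -> : (idm (X ⊗ Y) ⊠ (idm (ldual Y) ⊠ lev X ⊠ idm Y))
    ∘ (idm X ⊠ lcoev Y ⊠ idm (ldual X) ⊠ idm (X ⊗ Y))
  = (idm X ⊠ lcoev Y ⊠ idm Y) ∘ (idm X ⊠ lev X ⊠ idm Y).
  rewrite -!tens_id -!tensmA -!whl; [|ty..]; congr (_ ⊠ _).
  rewrite !tensmA -!whr; [|ty..]; congr (_ ⊠ _).
  rewrite !tens_id -tensmA tens_id exchl; [|ty..].
  by rewrite -{2}(tensm1l (lev X)) -{2}(tensm1r (lcoev Y)) exchr; ty.
rewrite !compA; [|ty..].
rewrite -{1}tens_id -!tensmA -whl; last by ty.
rewrite lsnake tens_id -compA; [|ty..].
rewrite -tens_id !tensmA -whr; last by ty.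
by rewrite lsnake !tens_id idl; ty.
Qed.

Lemma lev_ldual X : lev (ldual X) = ldualm (lcoev X).
Proof.
apply: (@ldualm_uniq _ 𝟙 (X ⊗ ldual X)).
- by split; ty.
- by rewrite ldual_tens ldual_one; split; ty.
rewrite lev1 tensm1r idl; last by ty.
rewrite levT ldual_tens -compA; [|ty..].
have -> : (idm (ldual (ldual X)) ⊠ lev X ⊠ idm (ldual X))
   ∘ (idm (ldual (ldual X) ⊗ ldual X) ⊠ lcoev X) = idm (ldual (ldual X) ⊗ ldual X).
  rewrite -!tens_id -!tensmA -whl; last by ty.
  by rewrite lsnake_dual.
by rewrite idr; ty.
Qed.

Lemma lcoev_ldual X : lcoev (ldual X) = ldualm (lev X).
Proof.
apply: (@ldualm_uniq _ (ldual X ⊗ X) 𝟙).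
- by split; ty.
- by rewrite ldual_tens ldual_one; split; ty.
rewrite lev1 ldual_one tensm1l idl; last by ty.
rewrite levT -compA; [|ty..].
rewrite -tens_id tensmA -whr; last by ty.
by rewrite lsnake !tens_id idr; ty.
Qed.

Lemma invertible_tens X Y : invertible X -> invertible Y -> invertible (X ⊗ Y).
Proof.
move=> [i1 i2] [j1 j2]; split.
- rewrite levT; apply: iso_comp => //; first by ty.
  by apply: iso_tens; [apply: iso_tens => //|]; exact: iso_id.
- rewrite lcoevT; apply: iso_comp => //; first by ty.
  by apply: iso_tens; [apply: iso_tens => //|]; exact: iso_id.
Qed.

Lemma invertible_ldual X : invertible X -> invertible (ldual X).
Proof.
by move=> [i1 i2]; split; rewrite ?lev_ldual ?lcoev_ldual; exact: iso_ldualm.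
Qed.

End Invertible.

Record heap : Type := Heap {
  heap_sort :> Type;
  heap_op : heap_sort -> heap_sort -> heap_sort -> heap_sort;
  heap_assoc : forall g h i j k,
    heap_op g h (heap_op i j k) = heap_op (heap_op g h i) j k;
  heap_idl : forall g h, heap_op g g h = h;
  heap_idr : forall g h, heap_op h g g = h
}.
Arguments heap_op {_}.

Definition heap_morphism (G H : heap) (f : G -> H) : Prop :=
  forall a b c, f (heap_op a b c) = heap_op (f a) (f b) (f c).

Definition classes (T : Type) (R : T -> T -> Prop) : Type :=
  {P : T -> Prop | exists x, P = R x}.

Section Classes.
Variables (T : Type) (R : T -> T -> Prop).

Definition class_of (x : T) : classes R := exist _ (R x) (ex_intro _ x erefl).
Definition class_repr (q : classes R) : T := projT1 (cid (proj2_sig q)).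

Lemma class_reprK q : class_of (class_repr q) = q.
Proof.
rewrite /class_repr; case: cid => x /= e; case: q e => P p /= e.
by apply: eq_exist; rewrite e.
Qed.

Hypothesis R_refl : forall x, R x x.
Hypothesis R_sym : forall x y, R x y -> R y x.
Hypothesis R_trans : forall x y z, R x y -> R y z -> R x z.

Lemma class_eq x y : class_of x = class_of y <-> R x y.
Proof.
split=> [[e]|h]; first by rewrite e; exact: R_refl.
apply: eq_exist; apply: funext => z; apply: propext.
by split=> ?; [apply: R_trans (R_sym h) _|apply: R_trans h _].
Qed.
End Classes.

Section Centres.
Variable C : strict_rigid.

Definition drinfeld_centre : Type := halfbraided (idF C) (idF C).
Definition anti_drinfeld_centre : Type := halfbraided (bidualF C) (idF C).

(* Duals and tensor products in Z(C) are those of C, so a pivotal structure of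
   Z(C) is a family of isomorphisms X -> X^∨∨ of Z(C), natural with respect to
   the morphisms of Z(C) and monoidal. *)
Record is_pivotal (phi : drinfeld_centre -> mor C) : Prop := IsPivotal {
  pivotal_iso : forall X, hiso X (hdual (hdual X)) (phi X);
  pivotal_nat : forall X Y f, hhom X Y f ->
    phi Y ∘ f = ldualm (ldualm f) ∘ phi X;
  pivotal_tens : forall X Y, phi (htens X Y) = phi X ⊠ phi Y;
  pivotal_unit : phi (hunit (idF C)) = idm 𝟙
}.

Definition pivotal_op (phi psi xi : drinfeld_centre -> mor C) X : mor C :=
  phi X ∘ inv (psi X) ∘ xi X.

Section PivotalFacts.
Variables (phi : drinfeld_centre -> mor C) (phiP : is_pivotal phi).
Lemma pivotal_hom X : is_hom (hob X) (ldual (ldual (hob X))) (phi X).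
Proof. by case: (pivotal_iso phiP X) => [[]]. Qed.
Lemma dom_pivotal X : dom (phi X) = hob X.
Proof. by case: (pivotal_hom X). Qed.
Lemma cod_pivotal X : cod (phi X) = ldual (ldual (hob X)).
Proof. by case: (pivotal_hom X). Qed.
Lemma pivotal_is_iso X : is_iso (phi X).
Proof. exact: hiso_iso (pivotal_iso phiP X). Qed.
Lemma dom_inv_pivotal X : dom (inv (phi X)) = ldual (ldual (hob X)).
Proof. by rewrite dom_inv ?cod_pivotal //; exact: pivotal_is_iso. Qed.
Lemma cod_inv_pivotal X : cod (inv (phi X)) = hob X.
Proof. by rewrite cod_inv ?dom_pivotal //; exact: pivotal_is_iso. Qed.
Lemma pivotal_invl X : inv (phi X) ∘ phi X = idm (hob X).
Proof. by rewrite invl ?dom_pivotal //; exact: pivotal_is_iso. Qed.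
Lemma pivotal_invr X : phi X ∘ inv (phi X) = idm (ldual (ldual (hob X))).
Proof. by rewrite invr ?cod_pivotal //; exact: pivotal_is_iso. Qed.
End PivotalFacts.

Lemma is_pivotal_op phi psi xi :
  is_pivotal phi -> is_pivotal psi -> is_pivotal xi ->
  is_pivotal (pivotal_op phi psi xi).
Proof.
move=> p q r.
have dp := dom_pivotal p; have dq := dom_pivotal q; have dr := dom_pivotal r.
have cp := cod_pivotal p; have cq := cod_pivotal q; have cr := cod_pivotal r.
have diq := dom_inv_pivotal q; have ciq := cod_inv_pivotal q.
split.
- move=> X; have [h1 _] := pivotal_iso p X; have [h2 _] := hiso_inv (pivotal_iso q X).
  have [h3 _] := pivotal_iso r X.
  apply: hiso_of_iso; first exact: hhom_comp h3 (hhom_comp h2 h1).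
  apply: iso_comp; [by ty|exact: pivotal_is_iso|].
  apply: iso_comp; [by ty|apply: is_iso_inv|]; exact: pivotal_is_iso.
- move=> X Y f hf; have [[d c] _] := hf.
  rewrite /pivotal_op.
  have e : inv (psi Y) ∘ ldualm (ldualm f) = f ∘ inv (psi X).
    rewrite -[LHS](@idr _ (ldual (ldual (hob X)))); last by ty.
    rewrite -(pivotal_invr q) compA; [|ty..].
    rewrite -(@compA _ _ _ (psi X)); [|ty..].
    rewrite -(pivotal_nat q hf) compA; [|ty..].
    by rewrite (pivotal_invl q) idl; ty.
  rewrite -compA; [|ty..].
  rewrite (pivotal_nat r hf) compA; [|ty..].
  rewrite -(@compA _ (phi Y)); [|ty..].
  rewrite e compA; [|ty..].
  by rewrite (pivotal_nat p hf) -!compA; ty.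
- move=> X Y; rewrite /pivotal_op (pivotal_tens p) (pivotal_tens q) (pivotal_tens r).
  have -> : inv (psi X ⊠ psi Y) = inv (psi X) ⊠ inv (psi Y).
    by apply: inv_eq; apply: inverse_tens; apply: invP; exact: pivotal_is_iso.
  by rewrite !tens_comp; ty.
- rewrite /pivotal_op (pivotal_unit p) (pivotal_unit q) (pivotal_unit r).
  by rewrite (inv_eq (inverse_id _)) !idl //; ty.
Qed.

Definition piv_type : Type := {phi : drinfeld_centre -> mor C | is_pivotal phi}.

Definition piv_op (phi psi xi : piv_type) : piv_type :=
  exist _ (pivotal_op (sval phi) (sval psi) (sval xi))
    (is_pivotal_op (proj2_sig phi) (proj2_sig psi) (proj2_sig xi)).

Definition Piv : heap.
Proof.
apply: (@Heap piv_type piv_op).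
- move=> [g p] [h q] [i r] [j s] [k t]; apply: eq_exist; apply: funext => X /=.
  rewrite /pivotal_op.
  have dp := dom_pivotal p; have dq := dom_pivotal q; have dr := dom_pivotal r.
  have cp := cod_pivotal p; have cq := cod_pivotal q; have cr := cod_pivotal r.
  have ds := dom_pivotal s; have cs := cod_pivotal s.
  have dt := dom_pivotal t; have ct := cod_pivotal t.
  have dis := dom_inv_pivotal s; have cis := cod_inv_pivotal s.
  have diq := dom_inv_pivotal q; have ciq := cod_inv_pivotal q.
  by rewrite !compA; ty.
- move=> [g p] [h q]; apply: eq_exist; apply: funext => X /=.
  by rewrite /pivotal_op (pivotal_invr p) idl // (cod_pivotal q).
- move=> [g p] [h q]; apply: eq_exist; apply: funext => X /=.
  rewrite /pivotal_op -compA ?(cod_pivotal p) ?(dom_inv_pivotal p) ?(cod_inv_pivotal p)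
    ?(dom_pivotal q) //.
  by rewrite (pivotal_invl p) idr // (dom_pivotal q).
Defined.

End Centres.

Section Picard.
Variable C : strict_rigid.
Local Notation ZC := (drinfeld_centre C).
Local Notation AC := (anti_drinfeld_centre C).

Definition invA : Type := {A : AC | invertible (hob A)}.
Definition invA_iso (A B : invA) : Prop := hisomorphic (sval A) (sval B).
Definition picA_type : Type := classes invA_iso.

Lemma invA_iso_refl A : invA_iso A A.
Proof. exact: hisomorphic_refl. Qed.
Lemma invA_iso_sym A B : invA_iso A B -> invA_iso B A.
Proof. exact: hisomorphic_sym. Qed.
Lemma invA_iso_trans A B D : invA_iso A B -> invA_iso B D -> invA_iso A D.
Proof. exact: hisomorphic_trans. Qed.

Lemma picA_eq (A B : invA) :
  class_of invA_iso A = class_of invA_iso B <-> invA_iso A B.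
Proof. exact: class_eq invA_iso_refl invA_iso_sym invA_iso_trans A B. Qed.

Definition invA_op (A B D : invA) : invA :=
  exist (fun A : AC => invertible (hob A))
    (htens (htens (sval A) (hdual (sval B))) (sval D))
    (invertible_tens
      (invertible_tens (proj2_sig A) (invertible_ldual (proj2_sig B)))
      (proj2_sig D)).

Lemma invA_op_iso A A' B B' D D' : invA_iso A A' -> invA_iso B B' ->
  invA_iso D D' -> invA_iso (invA_op A B D) (invA_op A' B' D').
Proof.
move=> hA hB hD; apply: hiso_htens => //; apply: hiso_htens => //.
exact: hiso_hdual.
Qed.

Definition picA_op (a b d : picA_type) : picA_type :=
  class_of invA_iso (invA_op (class_repr a) (class_repr b) (class_repr d)).

Lemma picA_opE A B D :
  picA_op (class_of _ A) (class_of _ B) (class_of _ D) = class_of _ (invA_op A B D).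
Proof.
by apply/picA_eq; apply: invA_op_iso; apply/picA_eq; exact: class_reprK.
Qed.

Lemma lev_cancel (A B : invA) : invA_iso (invA_op A B B) A.
Proof.
apply: (@hisomorphic_trans _ _ _ _ (htens (sval A) (hunit _))); last first.
  by rewrite htens1r; exact: hisomorphic_refl.
rewrite /= -htensA; apply: hiso_htens; first exact: hisomorphic_refl.
exists (lev (hob (sval B))); apply: hiso_of_iso; first exact: hhom_lev.
by case: (proj2_sig B).
Qed.

Lemma lcoev_cancel (A B : invA) : invA_iso (invA_op A A B) B.
Proof.
apply: (@hisomorphic_trans _ _ _ _ (htens (hunit _) (sval B))); last first.
  by rewrite htens1l; exact: hisomorphic_refl.
rewrite /=; apply: hiso_htens; last exact: hisomorphic_refl.
apply: hisomorphic_sym.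
exists (lcoev (hob (sval A))); apply: hiso_of_iso; first exact: hhom_lcoev.
by case: (proj2_sig A).
Qed.

Definition PicA : heap.
Proof.
apply: (@Heap picA_type picA_op).
- move=> g h i j k.
  rewrite -(class_reprK g) -(class_reprK h) -(class_reprK i) -(class_reprK j)
    -(class_reprK k) !picA_opE.
  apply/picA_eq; rewrite /invA_iso /= !htensA; exact: hisomorphic_refl.
- move=> g h; rewrite -(class_reprK g) -(class_reprK h) !picA_opE.
  by apply/picA_eq; exact: lcoev_cancel.
- move=> g h; rewrite -(class_reprK g) -(class_reprK h) !picA_opE.
  by apply/picA_eq; exact: lev_cancel.
Defined.

Definition picA_class (A : invA) : PicA := class_of invA_iso A.

(* SZ(C) is a full subcategory of Z(C) containing the unit and stable under
   tensor products and duals, so isomorphisms, duals and invertibility in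
   SZ(C) are those of Z(C). *)
Definition symmetric_object (X : ZC) : Prop :=
  forall Y : ZC, inv (hbr X (hob Y)) = hbr Y (hob X).

Definition centre_invertible (X : ZC) : Prop :=
  hiso (htens (hdual X) X) (hunit (idF C)) (lev (hob X))
  /\ hiso (hunit (idF C)) (htens X (hdual X)) (lcoev (hob X)).

Definition invSZ : Type :=
  {X : ZC | symmetric_object X /\ centre_invertible X}.
Definition invSZ_iso (X Y : invSZ) : Prop := hisomorphic (sval X) (sval Y).
Definition PicSZ : Type := classes invSZ_iso.

Lemma centre_invertibleP (X : ZC) : centre_invertible X <-> invertible (hob X).
Proof.
split=> [[h1 h2]|[h1 h2]].
  by split; [exact: hiso_iso h1|exact: hiso_iso h2].
split; apply: hiso_of_iso => //; [exact: hhom_lev|exact: hhom_lcoev].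
Qed.

Lemma picSZ_eq (X Y : invSZ) :
  class_of invSZ_iso X = class_of invSZ_iso Y <-> invSZ_iso X Y.
Proof.
apply: class_eq => [A|A B|A B D]; [exact: hisomorphic_refl|exact: hisomorphic_sym
  |exact: hisomorphic_trans].
Qed.

Definition invSZ_act (B : invSZ) (A : invA) : invA :=
  exist (fun A : AC => invertible (hob A)) (htens (sval B) (sval A))
    (invertible_tens (proj1 (centre_invertibleP _) (proj2 (proj2_sig B)))
       (proj2_sig A)).

Definition picSZ_act (b : PicSZ) (a : PicA) : PicA :=
  picA_class (invSZ_act (class_repr b) (class_repr a)).

Lemma invSZ_act_iso B B' A A' : invSZ_iso B B' -> invA_iso A A' ->
  invA_iso (invSZ_act B A) (invSZ_act B' A').
Proof. exact: hiso_htens. Qed.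

Lemma picSZ_actE B A :
  picSZ_act (class_of _ B) (picA_class A) = picA_class (invSZ_act B A).
Proof.
apply/picA_eq; apply: invSZ_act_iso.
  by apply/picSZ_eq; exact: class_reprK.
by apply/picA_eq; exact: class_reprK.
Qed.

(* The class [class_of same_orbit a] is the
   orbit {b · a | b in Pic SZ(C)}. *)
Definition same_orbit (a a' : PicA) : Prop := exists b, a' = picSZ_act b a.
Definition orbit_type : Type := classes same_orbit.
Definition orbit_proj (a : PicA) : orbit_type := class_of same_orbit a.

Lemma symmetric_hunit : symmetric_object (hunit (idF C)).
Proof.
by move=> Y; rewrite hbr_hunit hob_hunit hbr1 (inv_eq (inverse_id _)).
Qed.

Lemma symmetric_htens (X Y : ZC) :
  symmetric_object X -> symmetric_object Y -> symmetric_object (htens X Y).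
Proof.
move=> hX hY W; rewrite hob_htens hbr_tens /= -hX -hY.
apply: inv_eq; apply: inverse_comp; first by ty.
- by apply: inverse_tens; [exact: inverse_id|apply: invP; exact: hbr_iso].
- by apply: inverse_tens; [apply: invP; exact: hbr_iso|exact: inverse_id].
Qed.

Lemma symmetric_hdual (X : ZC) : symmetric_object X -> symmetric_object (hdual X).
Proof.
move=> hX Y; rewrite hob_hdual.
have i := hbr_iso Y (ldual (hob X)).
have e : inv (hbr Y (ldual (hob X))) = hbr (hdual X) (hob Y).
  apply: hdual_br_uniq; first by split; ty.
  rewrite hX /=.
  have n := hbr_nat Y (lev_hom (hob X)); rewrite hbr1 hbr_tens /= in n.
  rewrite idl in n; last by ty.
  rewrite -[RHS](@idr _ (ldual (hob X) ⊗ hob Y ⊗ hob X)); last by ty.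
  have -> : idm (ldual (hob X) ⊗ hob Y ⊗ hob X) =
     (hbr Y (ldual (hob X)) ⊠ idm (hob X)) ∘ (inv (hbr Y (ldual (hob X))) ⊠ idm (hob X)).
    by rewrite -whr ?invr // ?tens_id; ty.
  rewrite compA; [|ty..].
  by congr (_ ∘ _); rewrite -n compA; ty.
by rewrite -e; apply: inv_eq; apply: is_inverse_sym; exact: invP.
Qed.

Definition invSZ_unit : invSZ.
Proof.
exists (hunit (idF C)); split; first exact: symmetric_hunit.
apply/centre_invertibleP; rewrite /invertible hob_hunit lev1 lcoev1.
by split; exact: iso_id.
Defined.

Definition invSZ_tens (X Y : invSZ) : invSZ.
Proof.
exists (htens (sval X) (sval Y)).
have [sX /centre_invertibleP iX] := proj2_sig X.
have [sY /centre_invertibleP iY] := proj2_sig Y.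
split; first exact: symmetric_htens.
by apply/centre_invertibleP; exact: invertible_tens.
Defined.

Definition invSZ_dual (X : invSZ) : invSZ.
Proof.
exists (hdual (sval X)).
have [sX /centre_invertibleP iX] := proj2_sig X.
split; first exact: symmetric_hdual.
by apply/centre_invertibleP; exact: invertible_ldual.
Defined.

Lemma same_orbitP (A A' : invA) : same_orbit (picA_class A) (picA_class A') <->
  exists B : invSZ, invA_iso A' (invSZ_act B A).
Proof.
split=> [[b]|[B /picA_eq e]].
  by rewrite -(class_reprK b) picSZ_actE => /picA_eq ?; exists (class_repr b).
by exists (class_of _ B); rewrite picSZ_actE.
Qed.

Lemma same_orbit_refl a : same_orbit a a.
Proof.
rewrite -(class_reprK a); apply/same_orbitP; exists invSZ_unit.
by rewrite /invA_iso /= htens1l; exact: hisomorphic_refl.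
Qed.

Lemma same_orbit_sym a a' : same_orbit a a' -> same_orbit a' a.
Proof.
rewrite -(class_reprK a) -(class_reprK a') => /same_orbitP[B h].
apply/same_orbitP; exists (invSZ_dual B).
apply: (@hisomorphic_trans _ _ _ _
  (htens (hdual (sval B)) (htens (sval B) (sval (class_repr a))))); last first.
  by apply: hiso_htens; [exact: hisomorphic_refl|exact: hisomorphic_sym].
rewrite htensA -{1}[sval (class_repr a)]htens1l.
apply: hiso_htens; last exact: hisomorphic_refl.
apply: hisomorphic_sym; exists (lev (hob (sval B))).
by have [_ []] := proj2_sig B.
Qed.

Lemma same_orbit_trans a b d : same_orbit a b -> same_orbit b d -> same_orbit a d.
Proof.
rewrite -(class_reprK a) -(class_reprK b) -(class_reprK d).
move=> /same_orbitP[X h] /same_orbitP[Y k].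
apply/same_orbitP; exists (invSZ_tens Y X).
apply: hisomorphic_trans k _; rewrite /= -htensA.
by apply: hiso_htens => //; exact: hisomorphic_refl.
Qed.

Lemma orbit_eq a a' : orbit_proj a = orbit_proj a' <-> same_orbit a a'.
Proof. exact: class_eq same_orbit_refl same_orbit_sym same_orbit_trans a a'. Qed.

Lemma hhom_hbr (X Y : ZC) : hhom (htens X Y) (htens Y X) (hbr X (hob Y)).
Proof.
split; first by split; ty.
move=> W; rewrite !hbr_htens.
have hYW := hbr_hom Y W; have n := hbr_nat X hYW.
rewrite compA; [|ty..].
rewrite -(hbr_tens X W (hob Y)).
rewrite -n hbr_tens compA; ty.
Qed.

Lemma hisomorphic_braid (X Y : ZC) : hisomorphic (htens X Y) (htens Y X).
Proof.
by exists (hbr X (hob Y)); apply: hiso_of_iso; [exact: hhom_hbr|exact: hbr_iso].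
Qed.

Lemma same_orbit_op a a' b b' d d' : same_orbit a a' -> same_orbit b b' ->
  same_orbit d d' -> same_orbit (heap_op a b d) (heap_op a' b' d').
Proof.
rewrite -(class_reprK a) -(class_reprK b) -(class_reprK d).
rewrite -(class_reprK a') -(class_reprK b') -(class_reprK d').
set A := class_repr a; set B := class_repr b; set D := class_repr d.
move=> /same_orbitP[X hX] /same_orbitP[Y hY] /same_orbitP[W hW].
rewrite /= !picA_opE; apply/same_orbitP.
exists (invSZ_tens (invSZ_tens X (invSZ_dual Y)) W).
apply: invA_iso_trans (invA_op_iso hX hY hW) _.
rewrite /invA_iso /= hdual_htens !htensA.
set x := sval X; set y := hdual (sval Y); set w := sval W.
set p := sval A; set q := hdual (sval B).
apply: hiso_htens; last exact: hisomorphic_refl.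
have -> : htens (htens (htens (htens x p) q) y) w
   = htens x (htens (htens p q) (htens y w)) by rewrite !htensA.
have -> : htens (htens (htens (htens x y) w) p) q
   = htens x (htens (htens y w) (htens p q)) by rewrite !htensA.
apply: hiso_htens; first exact: hisomorphic_refl.
exact: hisomorphic_braid.
Qed.

Definition orbit_op (u v w : orbit_type) : orbit_type :=
  orbit_proj (heap_op (class_repr u) (class_repr v) (class_repr w)).

Lemma orbit_opE a b d :
  orbit_op (orbit_proj a) (orbit_proj b) (orbit_proj d) = orbit_proj (heap_op a b d).
Proof.
by apply/orbit_eq; apply: same_orbit_op; apply/orbit_eq; exact: class_reprK.
Qed.

Definition PicA_mod_PicSZ : heap.
Proof.
apply: (@Heap orbit_type orbit_op).
- move=> g h i j k.
  rewrite -(class_reprK g) -(class_reprK h) -(class_reprK i) -(class_reprK j)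
    -(class_reprK k) -!/(orbit_proj _) !orbit_opE.
  by rewrite heap_assoc.
- move=> g h; rewrite -(class_reprK g) -(class_reprK h) -!/(orbit_proj _) !orbit_opE.
  by rewrite heap_idl.
- move=> g h; rewrite -(class_reprK g) -(class_reprK h) -!/(orbit_proj _) !orbit_opE.
  by rewrite heap_idr.
Defined.

Definition orbit_projection : PicA -> PicA_mod_PicSZ := orbit_proj.

Lemma orbit_projection_morphism : heap_morphism orbit_projection.
Proof. by move=> a b d; rewrite /= orbit_opE. Qed.

Definition rho (A : invA) (X : ZC) : mor C :=
  let alpha := hob (sval A) in
  (idm (ldual (ldual (hob X))) ⊠ inv (lcoev alpha))
  ∘ (inv (hbr (hdual (hdual X)) alpha) ⊠ idm (ldual alpha))
  ∘ (inv (hbr (sval A) (hob X)) ⊠ idm (ldual alpha))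
  ∘ (idm (hob X) ⊠ lcoev alpha).

End Picard.

Definition piv_component (C : strict_rigid) (phi : Piv C) :
  drinfeld_centre C -> mor C := sval phi.

(* Main.v *)
From mathcomp Require Import all_boot.
From mathcomp Require Import boolp.
Require Import Defs.

(* Tensoring with an invertible object is faithful, so rho_A is characterised by
     hbr X^∨∨ α ∘ (rho_A,X ⊗ α) = (σ_A,X)^-1,
   i.e. inverting the half-braiding of A amounts to applying rho_A and then
   braiding past α inside Z(C).  This relation ([transports]) makes sense for
   every half-braided object.  It composes along tensor products,
   inverts under duals, and for S in Z(C) it holds with the identity exactly
   when S is symmetric.  Hence rho_(A ⊗ B^∨ ⊗ D) = rho_D rho_B^-1 rho_A, which is
   the heap product of pivotal structures because natural automorphisms of the
   identity functor commute; tensoring A with a symmetric S leaves rho_A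
   unchanged; and rho_A = rho_B makes B ⊗ A^∨ symmetric, while
   B ≅ (B ⊗ A^∨) ⊗ A.  That rho_A is a morphism of Z(C) follows from naturality of
   σ_A at σ_X,Y and of σ_X^∨∨ at σ_A,Y, using σ_X^∨∨,Y^∨∨ = (σ_X,Y)^∨∨. *)

Set Implicit Arguments.
Unset Strict Implicit.
Unset Printing Implicit Defensive.

Local Open Scope moncat_scope.

(** * Cancelling tensor factors and isomorphisms *)

Lemma tensr_unit_inj (C : strict_monoidal) (X Y W : ob C) (w f g : mor C) :
  is_hom W 𝟙 w -> is_iso w -> is_hom X Y f -> is_hom X Y g ->
  f ⊠ idm W = g ⊠ idm W -> f = g.
Proof.
move=> hw iw.
have hv : is_hom 𝟙 W (inv w) by split; rewrite ?dom_inv ?cod_inv ?(proj1 hw) ?(proj2 hw).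
(* Since the unit is strict, [h] is recovered from [h ⊠ idm W] by conjugating with [w]. *)
have E h : is_hom X Y h -> h = (idm Y ⊠ w) ∘ (h ⊠ idm W) ∘ (idm X ⊠ inv w).
  move=> hh; rewrite exchl; [|ty..].
  rewrite -[h ⊠ w](@exchr _ X 𝟙); [|ty..].
  rewrite -compA; [|ty..].
  by rewrite -whl ?invr // ?(proj2 hw) ?tens_id ?tensm1r ?idr; ty.
by move=> hf hg e; rewrite (E f) // (E g) // e.
Qed.

Lemma comp_isor_inj (C : strict_monoidal) (u f g : mor C) : is_iso u ->
  cod u = dom f -> cod u = dom g -> f ∘ u = g ∘ u -> f = g.
Proof.
move=> iu df dg e.
have E h : cod u = dom h -> h = h ∘ u ∘ inv u.
  move=> dh; rewrite -compA ?cod_inv ?dom_inv //.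
  by rewrite invr // idr.
by rewrite (E f) // (E g) // e.
Qed.

Lemma comp_isol_inj (C : strict_monoidal) (u f g : mor C) : is_iso u ->
  cod f = dom u -> cod g = dom u -> u ∘ f = u ∘ g -> f = g.
Proof.
move=> iu df dg e.
have E h : cod h = dom u -> h = inv u ∘ (u ∘ h).
  move=> dh; rewrite compA ?cod_inv ?dom_inv //.
  by rewrite invl // idl.
by rewrite (E f) // (E g) // e.
Qed.

Section Invertible.
Variable C : rigid.
Implicit Types (X Y a : ob C) (f g : mor C).

(** Tensoring once more with [ldual a] leaves the factor [a ⊗ ldual a], which is isomorphic to the
    unit. *)
Lemma tensr_inj X Y a f g : invertible a -> is_hom X Y f -> is_hom X Y g ->
  f ⊠ idm a = g ⊠ idm a -> f = g.
Proof.
move=> [_ ia] hf hg e.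
apply: (@tensr_unit_inj C X Y (a ⊗ ldual a) (inv (lcoev a))) => //.
- by split; rewrite ?dom_inv ?cod_inv; ty.
- exact: is_iso_inv.
- by rewrite -tens_id !tensmA e.
Qed.

(** Fullness of tensoring with an invertible object, with explicit preimage. The two sides agree
    after tensoring with [ldual a], by sliding the preimage past [lcoev a]; the factor [ldual a ⊗ a]
    is then cancelled along [lev a]. *)
Lemma untens_lcoev X Y a f : invertible a -> is_hom (X ⊗ a) (Y ⊗ a) f ->
  ((idm Y ⊠ inv (lcoev a)) ∘ (f ⊠ idm (ldual a)) ∘ (idm X ⊠ lcoev a)) ⊠ idm a = f.
Proof.
move=> [il ic] hf; set r := _ ∘ _ ∘ _.
have hv : is_hom (a ⊗ ldual a) 𝟙 (inv (lcoev a)) by split; rewrite ?dom_inv ?cod_inv; ty.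
have hr : is_hom X Y r by rewrite /r; split; ty.
have e : r ⊠ idm a ⊠ idm (ldual a) = f ⊠ idm (ldual a).
  apply: (@comp_isor_inj _ (idm X ⊠ lcoev a)); [|by ty..|].
    by apply: iso_tens => //; exact: iso_id.
  rewrite -tensmA tens_id exchr; [|ty..].
  rewrite -[LHS](@exchl _ Y 𝟙); [|ty..].
  rewrite tensm1r /r -[_ ∘ _ ∘ _]compA; [|ty..].
  rewrite compA; [|ty..].
  by rewrite -whl ?invr // ?cod_lcoev ?tens_id ?idl; ty.
apply: (@tensr_unit_inj C (X ⊗ a) (Y ⊗ a) (ldual a ⊗ a) (lev a)) => //.
- by split; ty.
- by split; ty.
- by rewrite -tens_id !tensmA e.
Qed.

End Invertible.

(** * The arrows [rho], and half-braidings of dual objects *)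

Section Rho.
Variable C : strict_rigid.
Local Notation ZC := (drinfeld_centre C).

Lemma rho_hom (A : invA C) (X : ZC) :
  is_hom (hob X) (ldual (ldual (hob X))) (rho A X).
Proof.
have [_ ic] := proj2_sig A.
have hv : is_hom (hob (sval A) ⊗ ldual (hob (sval A))) 𝟙 (inv (lcoev (hob (sval A)))).
  by split; rewrite ?dom_inv ?cod_inv; ty.
by rewrite /rho; split; ty.
Qed.

Lemma rho_tens (A : invA C) (X : ZC) :
  rho A X ⊠ idm (hob (sval A))
  = inv (hbr (hdual (hdual X)) (hob (sval A))) ∘ inv (hbr (sval A) (hob X)).
Proof.
have hv : is_hom (hob (sval A) ⊗ ldual (hob (sval A))) 𝟙 (inv (lcoev (hob (sval A)))).
  by have [_ ?] := proj2_sig A; split; rewrite ?dom_inv ?cod_inv; ty.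
rewrite -[RHS](@untens_lcoev _ (hob X) (ldual (ldual (hob X))) (hob (sval A))).
- by congr (_ ⊠ _); rewrite /rho whr ?compA; ty.
- exact: (proj2_sig A).
- by split; ty.
Qed.

Lemma is_iso_rho (A : invA C) (X : ZC) : is_iso (rho A X).
Proof.
have [_ ic] := proj2_sig A; have i := is_iso_inv ic.
have hv : is_hom (hob (sval A) ⊗ ldual (hob (sval A))) 𝟙 (inv (lcoev (hob (sval A)))).
  by split; rewrite ?dom_inv ?cod_inv; ty.
have j L R (B : halfbraided L R) Y : is_iso (inv (hbr B Y)) by apply/is_iso_inv/hbr_iso.
rewrite /rho; apply: iso_comp; [by ty|by apply: iso_tens => //; exact: iso_id|].
apply: iso_comp; [by ty|by apply: iso_tens => //; exact: iso_id|].
apply: iso_comp; [by ty|by apply: iso_tens => //; exact: iso_id|].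
by apply: iso_tens => //; exact: iso_id.
Qed.

(** The dual half-braiding is determined by its pairing with [lev (hob X)]; pairing also with
    [lev Y] produces the nested evaluation of a tensor product, which defines [ldualm]. *)
Lemma hbr_ldual (X : ZC) Y : hbr (hdual X) (ldual Y) = ldualm (hbr X Y).
Proof.
have hh : is_hom (hob X ⊗ Y) (Y ⊗ hob X) (hbr X Y) by exact: hbr_hom.
have hd : is_hom (ldual (hob X) ⊗ ldual Y) (ldual Y ⊗ ldual (hob X)) (ldualm (hbr X Y)).
  by rewrite -!ldual_tens; exact: hom_ldualm.
symmetry; apply: hdual_br_uniq => //=.
(* Naturality at [lev Y] makes the inverse half-braiding at [ldual Y] the mate of [hbr X Y]. *)
have e : (lev Y ⊠ idm (hob X)) ∘ (idm (ldual Y) ⊠ hbr X Y)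
    = (idm (hob X) ⊠ lev Y) ∘ (inv (hbr X (ldual Y)) ⊠ idm Y).
  apply: (@comp_isor_inj _ (hbr X (ldual Y) ⊠ idm Y)); [|by ty..|].
    by apply: iso_tens; [exact: hbr_iso|exact: iso_id].
  have := hbr_nat X (lev_hom Y); rewrite hbr1 hbr_tens /= idl; last by ty.
  rewrite compA; [|by ty..] => ->.
  rewrite -compA; [|by ty..].
  rewrite -whr; last by ty.
  by rewrite (invl (hbr_iso _ _)) dom_hbr /= tens_id idr; ty.
have hv : is_hom (ldual Y ⊗ hob X) (hob X ⊗ ldual Y) (inv (hbr X (ldual Y))).
  by split; ty.
have de := ldualmE hh.
move: (ldualm (hbr X Y)) hd de => d hd de.
apply: (@bend_inj _ (ldual (hob X) ⊗ ldual Y ⊗ hob X) 𝟙 Y); [by split; ty..|].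
rewrite !tensm1l.
transitivity (lev (hob X) ∘ (idm (ldual (hob X)) ⊠ ((idm (hob X) ⊠ lev Y) ∘ (inv (hbr X (ldual Y)) ⊠ idm Y)))).
  rewrite -e whr; last by ty.
  rewrite compA; [|by ty..].
  rewrite -levT -tensmA tens_id de levT.
  rewrite ldual_tens whl; last by ty.
  by rewrite -tens_id !tensmA compA; ty.
rewrite whl; last by ty.
rewrite compA; [|by ty..].
rewrite [in RHS]whr; last by ty.
rewrite [in RHS]compA; [|by ty..].
rewrite -!tensmA tens_id; congr (_ ∘ _).
rewrite tensmA tens_id -{1}(tensm1r (lev (hob X))) exchr; [|by ty..].
by rewrite -{2}(tensm1l (lev Y)) exchl; ty.
Qed.

Lemma hbr_bidual (X : ZC) Y :
  hbr (hdual (hdual X)) (ldual (ldual Y)) = ldualm (ldualm (hbr X Y)).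
Proof. by rewrite !hbr_ldual. Qed.

End Rho.

(** * Calculus of transports: tensor products and duals *)

Lemma inv_hbr_htens (C : strict_monoidal) (L M R : smendo C)
  (A : halfbraided M R) (B : halfbraided L M) Y :
  inv (hbr (htens A B) Y)
  = (idm (hob A) ⊠ inv (hbr B Y)) ∘ (inv (hbr A Y) ⊠ idm (hob B)).
Proof.
apply: inv_eq; rewrite hbr_htens; apply: inverse_comp; first by ty.
- by apply: inverse_tens; [exact: inverse_id|apply: invP; exact: hbr_iso].
- by apply: inverse_tens; [apply: invP; exact: hbr_iso|exact: inverse_id].
Qed.

Lemma inv_eq_right (C : strict_monoidal) (f g : mor C) : is_iso f ->
  cod g = dom f -> f ∘ g = idm (cod f) -> inv f = g.
Proof.
move=> i e fg; rewrite -[LHS](@idr _ (cod f)) ?dom_inv // -fg.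
by rewrite compA ?cod_inv ?dom_inv // invl // idl.
Qed.

Section Transport.
Variable C : strict_rigid.
Local Notation ZC := (drinfeld_centre C).

(* For x the object underlying P and Q up to bidualisation: moving x past A by
   the inverse half-braiding of A is [r] followed by the braiding of Z(C). *)
Record transports (L R : smendo C) (A : halfbraided L R) (x : ob C) (P Q : ZC)
    (r : mor C) : Prop := Transports {
  transports_dom : hob P = fob R x;
  transports_cod : hob Q = fob L x;
  transports_hhom : hhom P Q r;
  transportsE : inv (hbr A x) = hbr Q (hob A) ∘ (r ⊠ idm (hob A))
}.

Lemma transports_uniq (L R : smendo C) (A : halfbraided L R) x P Q r r' :
  invertible (hob A) -> transports A x P Q r -> transports A x P Q r' -> r = r'.
Proof.
move=> iA [_ _ [h _] e] [_ _ [h' _] e'].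
apply: (tensr_inj iA h h'); apply: (@comp_isol_inj _ (hbr Q (hob A))).
- exact: hbr_iso.
- by ty.
- by ty.
- by rewrite -e -e'.
Qed.

(** The inverse half-braiding of [A ⊗ B] passes [A] first, so [r] acts before [s]; being a morphism
    of Z(C), [s] slides past the braiding with [A]. *)
Lemma transports_htens (L M R : smendo C) (A : halfbraided M R)
    (B : halfbraided L M) x P N Q r s :
  transports A x P N r -> transports B x N Q s ->
  transports (htens A B) x P Q (s ∘ r).
Proof.
move=> [dP dN hr er] [_ dQ hs es].
split=> //; first exact: hhom_comp hr hs.
have [hr1 _] := hr; have [hs1 hs2] := hs.
rewrite inv_hbr_htens er es.
rewrite whl; last by ty.
rewrite (whr (hob B)); last by ty.
rewrite hob_htens hbr_tens whr; last by ty.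
rewrite -!compA; [|by ty..].
congr (_ ∘ _).
rewrite compA; [|by ty..].
rewrite tensmA -whr; last by ty.
have /= -> := hs2 (hob A).
rewrite whr; last by ty.
by rewrite -compA -?tens_id ?tensmA; ty.
Qed.

(** Bending along [lev (hob A)], naturality of the braiding of [Q] at this evaluation shows that the
    half-braiding of the dual, after the braiding of [P], is [r] tensored with an identity. *)
Lemma transports_hdual (L R : smendo C) (A : halfbraided L R) x P Q r :
  is_iso r -> transports A x P Q r -> transports (hdual A) x Q P (inv r).
Proof.
move=> ir [dP dQ hr er].
have [hr1 hr2] := hr.
have hv : is_hom (hob Q) (hob P) (inv r).
  by split; rewrite ?dom_inv ?cod_inv ?(proj1 hr1) ?(proj2 hr1).
split=> //; first by have [] := hiso_inv (hiso_of_iso hr ir).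
have hA : is_hom (ldual (hob A) ⊗ hob P) (hob Q ⊗ ldual (hob A)) (hbr (hdual A) x).
  by rewrite dP dQ; exact: hbr_hom.
have it := hbr_iso (hdual A) x.
have := hdual_hbrE A x; rewrite -dQ er.
move: (hbr (hdual A) x) hA it => t ht it hE.
have e : t ∘ hbr P (ldual (hob A)) = r ⊠ idm (ldual (hob A)).
  apply: (@bend_inj _ (hob P ⊗ ldual (hob A)) (hob Q) (hob A)); [by split; ty..|].
  rewrite whr; last by ty.
  rewrite compA; [|by ty..].
  rewrite hE whl; last by ty.
  rewrite -!compA; [|by ty..].
  rewrite (tensmA (idm (ldual (hob A)))) -whr; last by ty.
  have /= -> := hr2 (ldual (hob A)).
  rewrite whr; last by ty.
  rewrite (@compA _ _ _ (r ⊠ _ ⊠ _)); [|by ty..].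
  have /= <- := hbr_tens Q (ldual (hob A)) (hob A).
  rewrite compA; [|by ty..].
  have /= -> := hbr_nat Q (lev_hom (hob A)).
  by rewrite hbr1 idl; ty.
apply: inv_eq_right => //; first by ty.
rewrite compA; [|by ty..].
rewrite e -whr; last by ty.
by rewrite (invr ir) (proj2 hr1) tens_id (proj2 ht).
Qed.

End Transport.

(** The diagram behind [hhom_rho], with [r] as rho. Primes stand for biduals; [c], [c'], [q], [p]
    are braidings of X or its bidual, and [s], [u] are half-braidings of A. *)
Lemma hexagon_transport (C : strict_monoidal) (a x x' y y' : ob C)
    (c c' q s u p r : mor C) :
  is_hom (x ⊗ y) (y ⊗ x) c -> is_hom (x' ⊗ y') (y' ⊗ x') c' ->
  is_hom (x' ⊗ y) (y ⊗ x') q -> is_hom (a ⊗ y') (y ⊗ a) s ->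
  is_hom (a ⊗ x') (x ⊗ a) u -> is_hom (x' ⊗ a) (a ⊗ x') p -> is_hom x x' r ->
  is_iso s -> is_iso u -> is_iso p ->
  p ∘ (r ⊠ idm a) ∘ u = idm (a ⊗ x') ->
  (c ⊠ idm a) ∘ ((idm x ⊠ s) ∘ (u ⊠ idm y'))
    = (idm y ⊠ u) ∘ (s ⊠ idm x') ∘ (idm a ⊠ c') ->
  (s ⊠ idm x') ∘ ((idm a ⊠ c') ∘ (p ⊠ idm y'))
    = (idm y ⊠ p) ∘ (q ⊠ idm a) ∘ (idm x' ⊠ s) ->
  ((idm y ⊠ r) ∘ c) ⊠ idm a = (q ∘ (r ⊠ idm y)) ⊠ idm a.
Proof.
move=> hc hc' hq hs hu hp hr ks ku kp e nA nX.
apply: (@comp_isol_inj _ (idm y ⊠ p)); [|by ty..|].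
  by apply: iso_tens => //; exact: iso_id.
apply: (@comp_isor_inj _ ((idm x ⊠ s) ∘ (u ⊠ idm y'))); [|by ty..|].
  by apply: iso_comp; [ty|apply: iso_tens|apply: iso_tens] => //; exact: iso_id.
rewrite !whr; [|by ty..].
(* Both sides reduce to this arrow: one by naturality of the half-braiding of A, the other by that
   of the bidual of X. *)
transitivity ((s ⊠ idm x') ∘ (idm a ⊠ c')).
  rewrite -!compA; [|by ty..].
  rewrite nA; rewrite !compA; [|by ty..].
  rewrite -(tensmA (idm y)) -!whl; [|by ty..].
  by rewrite e tens_id idl; ty.
rewrite -!compA; [|by ty..].
have -> : (r ⊠ idm y ⊠ idm a) ∘ ((idm x ⊠ s) ∘ (u ⊠ idm y'))
    = (idm x' ⊠ s) ∘ ((r ⊠ idm a ⊠ idm y') ∘ (u ⊠ idm y')).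
  rewrite !compA; [|by ty..].
  congr (_ ∘ _); rewrite -!tensmA !tens_id.
  by symmetry; apply: exch.
rewrite (@compA _ (q ⊠ idm a)); [|by ty..].
rewrite compA; [|by ty..].
rewrite (@compA _ (idm y ⊠ p)); [|by ty..].
rewrite -nX -!compA; [|by ty..].
by rewrite -!whr ?compA ?e ?tens_id ?idr; ty.
Qed.

(** * [rho A] is a pivotal structure of Z(C) *)

Section RhoPivotal.
Variable C : strict_rigid.
Local Notation ZC := (drinfeld_centre C).

Lemma hbr_rho (A : invA C) (X : ZC) :
  hbr (hdual (hdual X)) (hob (sval A)) ∘ (rho A X ⊠ idm (hob (sval A)))
  = inv (hbr (sval A) (hob X)).
Proof.
rewrite rho_tens compA; [|by ty..].
by rewrite (invr (hbr_iso _ _)) idl; ty.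
Qed.

Lemma hhom_rho (A : invA C) (X : ZC) : hhom X (hdual (hdual X)) (rho A X).
Proof.
have hr := rho_hom A X; split=> // Y.
have kE := hbr_rho A X; have iA := proj2_sig A.
have hX : is_hom (hob X ⊗ Y) (Y ⊗ hob X) (hbr X Y) by exact: hbr_hom.
have hA : is_hom (hob (sval A) ⊗ ldual (ldual Y)) (Y ⊗ hob (sval A)) (hbr (sval A) Y).
  exact: hbr_hom.
apply: (@tensr_inj _ (hob X ⊗ Y) (Y ⊗ ldual (ldual (hob X))) (hob (sval A))) => //.
- by split; ty.
- by split; ty.
apply: (@hexagon_transport _ _ _ (ldual (ldual (hob X))) _ (ldual (ldual Y)) _
  (hbr (hdual (hdual X)) (ldual (ldual Y))) _
  (hbr (sval A) Y) (hbr (sval A) (hob X)) (hbr (hdual (hdual X)) (hob (sval A))));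
  try exact: hbr_hom; try exact: hbr_iso => //.
- exact: hr.
- by rewrite kE (invl (hbr_iso _ _)); ty.
- have := hbr_nat (sval A) hX; rewrite /= -hbr_bidual !hbr_tens => n; exact: n.
- have := hbr_nat (hdual (hdual X)) hA; rewrite !hbr_tens => n; exact: n.
Qed.

Lemma transports_rho (A : invA C) (X : ZC) :
  transports (sval A) (hob X) X (hdual (hdual X)) (rho A X).
Proof. by split=> //; [exact: hhom_rho|rewrite hbr_rho]. Qed.

(** Reduces computing [rho] to exhibiting a transport. *)
Lemma eq_rho (A : invA C) (X : ZC) r :
  transports (sval A) (hob X) X (hdual (hdual X)) r -> r = rho A X.
Proof. by move=> h; apply: transports_uniq h (transports_rho A X); exact: proj2_sig A. Qed.

Lemma hiso_rho (A : invA C) (X : ZC) : hiso X (hdual (hdual X)) (rho A X).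
Proof. by apply: hiso_of_iso; [exact: hhom_rho|exact: is_iso_rho]. Qed.

Lemma inv_hbr_hhom (L R : smendo C) (A B : halfbraided L R) t x : hhom A B t ->
  inv (hbr B x) ∘ (idm (fob R x) ⊠ t) = (t ⊠ idm (fob L x)) ∘ inv (hbr A x).
Proof.
move=> [ht e].
apply: (@comp_isol_inj _ (hbr B x)); [exact: hbr_iso|by ty..|].
apply: (@comp_isor_inj _ (hbr A x)); [exact: hbr_iso|by ty..|].
rewrite compA; [|by ty..].
rewrite (invr (hbr_iso _ _)) idl; [|by ty..].
rewrite e -!compA; [|by ty..].
by rewrite (invl (hbr_iso _ _)) idr; ty.
Qed.

(** Tensored with the invertible object and followed by the braiding, this is naturality of the
    inverse half-braiding of [A] at [f], since the bidual of [f] is a morphism of Z(C). *)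
Lemma rho_nat (A : invA C) (X Y : ZC) f : hhom X Y f ->
  rho A Y ∘ f = ldualm (ldualm f) ∘ rho A X.
Proof.
move=> hf; have [hf1 _] := hf.
have hff := hom_ldualm (hom_ldualm hf1).
have [_ e] := hhom_ldualm (hhom_ldualm hf).
have hX := rho_hom A X; have hY := rho_hom A Y.
apply: (@tensr_inj _ (hob X) (ldual (ldual (hob Y))) (hob (sval A))).
- exact: proj2_sig A.
- by split; ty.
- by split; ty.
apply: (@comp_isol_inj _ (hbr (hdual (hdual Y)) (hob (sval A)))); [exact: hbr_iso|by ty..|].
rewrite (@whr _ _ _ f); last by ty.
rewrite (@whr _ _ (ldualm (ldualm f)) (rho A X)); last by ty.
rewrite !compA; [|by ty..].
rewrite hbr_rho.
have /= n := inv_hbr_nat (sval A) hf1; rewrite n.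
have en : idm (hob (sval A)) ⊠ ldualm (ldualm f) ∘ hbr (hdual (hdual X)) (hob (sval A))
    = hbr (hdual (hdual Y)) (hob (sval A)) ∘ ldualm (ldualm f) ⊠ idm (hob (sval A)).
  exact: e.
rewrite -en -(@compA _ _ _ (rho A X ⊠ _)); [|by ty..].
by rewrite hbr_rho.
Qed.

Lemma rho_htens (A : invA C) (X Y : ZC) : rho A (htens X Y) = rho A X ⊠ rho A Y.
Proof.
have hX := rho_hom A X; have hY := rho_hom A Y.
symmetry; apply: eq_rho; split=> //.
  by rewrite !hdual_htens; apply: hhom_htens; exact: hhom_rho.
have hp := hbr_hom (hdual (hdual X)) (hob (sval A)).
have hq := hbr_hom (hdual (hdual Y)) (hob (sval A)).
rewrite !hdual_htens hob_htens inv_hbr_tens -!hbr_rho hbr_htens !hob_hdual.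
move: (hbr (hdual (hdual X)) _) (hbr (hdual (hdual Y)) _) (rho A X) (rho A Y)
  hX hY hp hq => p q rX rY hX hY hp hq.
rewrite /= in hp hq *.
rewrite -(@exchr _ (hob X) (ldual (ldual (hob Y))) rX rY); [|by ty..].
rewrite !whr; [|by ty..].
rewrite whl; last by ty.
rewrite -!compA; [|by ty..].
congr (_ ∘ _).
rewrite -(tensmA (idm (hob X))) !compA; [|by ty..].
congr (_ ∘ _).
rewrite -!tensmA !tens_id.
by symmetry; apply: exch.
Qed.

(** Monoidality makes this component an idempotent, and an invertible idempotent is an identity. *)
Lemma rho_hunit (A : invA C) : rho A (hunit (idF C)) = idm 𝟙.
Proof.
have h := rho_hom A (hunit (idF C)); rewrite /= !ldual_one in h.
have i := is_iso_rho A (hunit (idF C)).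
have := rho_htens A (hunit (idF C)) (hunit (idF C)); rewrite htens1l.
move: (rho A _) h i => r h i e.
apply: (@comp_isol_inj _ r) => //; [by ty..|].
rewrite idr; last by ty.
by rewrite [RHS]e -(@exchl _ 𝟙 𝟙) ?tensm1l ?tensm1r; ty.
Qed.

Lemma is_pivotal_rho (A : invA C) : is_pivotal (rho A).
Proof.
split; [exact: hiso_rho|exact: rho_nat|exact: rho_htens|exact: rho_hunit].
Qed.

End RhoPivotal.

(** * The heap morphism [kappa] and its fibres *)

Section Kappa.
Variable C : strict_rigid.
Local Notation ZC := (drinfeld_centre C).

(** The isomorphism [t] intertwines the half-braidings of [A] and [B], and the braiding of [Q] is
    natural at [t]. *)
Lemma transports_hisomorphic (L R : smendo C) (A B : halfbraided L R) x (P Q : ZC) r :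
  hisomorphic A B -> transports A x P Q r -> transports B x P Q r.
Proof.
move=> [t ht] [dP dQ hr er]; split=> //.
have it := hiso_iso ht; have [[ht1 ht2] _] := ht; have [hr1 _] := hr.
apply: (@comp_isor_inj _ (idm (hob P) ⊠ t)).
- by apply: iso_tens => //; exact: iso_id.
- by ty; rewrite dP.
- by ty.
rewrite {1}dP (inv_hbr_hhom _ (proj1 ht)) er -dQ.
rewrite -[RHS]compA; [|by ty..].
rewrite (@exchr _ (hob P) (hob B) r t); [|by ty..].
rewrite -(@exchl _ (hob Q) (hob A) r t); [|by ty..].
rewrite !compA; [|by ty..].
by have /= -> := hbr_nat Q ht1.
Qed.

Lemma rho_iso (A B : invA C) (X : ZC) : invA_iso A B -> rho A X = rho B X.
Proof.
move=> h; apply: eq_rho.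
exact: transports_hisomorphic h (transports_rho A X).
Qed.

Lemma rho_invA_op (A B D : invA C) (X : ZC) :
  rho (invA_op A B D) X = rho D X ∘ (inv (rho B X) ∘ rho A X).
Proof.
symmetry; apply: eq_rho.
apply: transports_htens (transports_rho D X).
apply: transports_htens (transports_rho A X) _.
exact: transports_hdual (is_iso_rho B X) (transports_rho B X).
Qed.

(* [psi^-1 xi] is a natural endomorphism of the identity functor, and by
   naturality [phi] intertwines it with its bidual [xi psi^-1]. *)
Lemma pivotal_opC (phi psi xi : ZC -> mor C) X :
  is_pivotal phi -> is_pivotal psi -> is_pivotal xi ->
  pivotal_op phi psi xi X = pivotal_op xi psi phi X.
Proof.
move=> p q r; rewrite /pivotal_op.
have hp := pivotal_hom p X; have hq := pivotal_hom q X; have hr := pivotal_hom r X.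
have hi : is_hom (ldual (ldual (hob X))) (hob X) (inv (psi X)).
  by split; [exact: dom_inv_pivotal|exact: cod_inv_pivotal].
pose v := inv (psi X) ∘ xi X.
have hv : hhom X X v.
  apply: hhom_comp (proj1 (pivotal_iso r X)) _.
  exact: proj1 (hiso_inv (pivotal_iso q X)).
have hv1 := proj1 hv; have hv2 := hom_ldualm (hom_ldualm hv1).
rewrite -compA; [|by ty..].
rewrite -/v (pivotal_nat p hv); congr (_ ∘ _).
(* Naturality of [psi] at [v] identifies the bidual of [v], since [psi X ∘ v = xi X]. *)
apply: (@comp_isor_inj _ (psi X)); [exact: pivotal_is_iso|by rewrite (proj2 hq) (proj1 hv2)|by ty|].
rewrite -(pivotal_nat q hv) /v -[RHS]compA; [|by ty..].
rewrite (pivotal_invl q) compA; [|by ty..].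
by rewrite (pivotal_invr q) idl ?idr; ty.
Qed.

Lemma symmetric_transports (S : ZC) :
  symmetric_object S <-> forall X : ZC, transports S (hob X) X X (idm (hob X)).
Proof.
split=> [h X|h X].
  by split=> //; [exact: hhom_id|rewrite h tens_id idr //; ty].
by rewrite (transportsE (h X)) tens_id idr //; ty.
Qed.

Lemma rho_invSZ_act (S : invSZ C) (A : invA C) (X : ZC) :
  rho (invSZ_act S A) X = rho A X.
Proof.
symmetry; apply: eq_rho.
(* The identity is the transport contributed by the symmetric factor. *)
rewrite -[rho A X](@idr _ (hob X)); last by case: (rho_hom A X).
apply: transports_htens (transports_rho A X).
by apply: (symmetric_transports _).1; case: (proj2_sig S).
Qed.

Lemma symmetric_quotient (A B : invA C) : rho A = rho B ->
  symmetric_object (htens (sval B) (hdual (sval A))).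
Proof.
move=> e; apply/symmetric_transports => X.
have i := is_iso_rho A X; have h := rho_hom A X.
have -> : idm (hob X) = inv (rho A X) ∘ rho B X by rewrite -e invl // (proj1 h).
apply: transports_htens (transports_rho B X) _.
exact: transports_hdual i (transports_rho A X).
Qed.

Lemma same_orbit_rho (A B : invA C) :
  same_orbit (picA_class A) (picA_class B) <-> rho A = rho B.
Proof.
split=> [/same_orbitP[S h]|e].
  by apply: funext => X; rewrite (rho_iso X h) rho_invSZ_act.
have iS : centre_invertible (htens (sval B) (hdual (sval A))).
  apply/centre_invertibleP; apply: invertible_tens; first exact: proj2_sig B.
  by apply: invertible_ldual; exact: proj2_sig A.
(* With this witness, [invSZ_act] on [A] unfolds to [invA_op B A A]. *)
apply/same_orbitP; exists (exist (fun S : ZC => symmetric_object S /\ centre_invertible S) _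
  (conj (symmetric_quotient e) iS)).
by apply: invA_iso_sym; exact: lev_cancel.
Qed.

Definition kappa (a : PicA C) : Piv C := exist _ _ (is_pivotal_rho (class_repr a)).

(** Independence of the representative chosen in [kappa]. *)
Lemma kappaE (A : invA C) (X : ZC) : piv_component (kappa (picA_class A)) X = rho A X.
Proof. by apply: rho_iso; apply/picA_eq; exact: class_reprK. Qed.

Lemma Piv_eq (phi psi : Piv C) :
  (forall X, piv_component phi X = piv_component psi X) -> phi = psi.
Proof. by case: phi psi => [phi p] [psi q] e; apply: eq_exist; exact: funext. Qed.

Lemma kappa_morphism : heap_morphism kappa.
Proof.
move=> a b d; apply: Piv_eq => X.
have -> : heap_op a b d = picA_class (invA_op (class_repr a) (class_repr b) (class_repr d)).
  by [].
rewrite kappaE rho_invA_op.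
have [ha hb hd] := And3 (rho_hom (class_repr a) X) (rho_hom (class_repr b) X)
  (rho_hom (class_repr d) X).
have i := is_iso_rho (class_repr b) X.
rewrite compA ?dom_inv ?cod_inv ?(proj1 ha) ?(proj2 ha) ?(proj1 hb) ?(proj2 hb) ?(proj1 hd) //.
(* [rho_invA_op] yields the three factors in the reverse of the heap order. *)
by apply: pivotal_opC; exact: is_pivotal_rho.
Qed.

(** Gives both that [kappa] descends to orbits and that the induced map is injective. *)
Lemma kappa_eq (a b : PicA C) : kappa a = kappa b <-> orbit_proj a = orbit_proj b.
Proof.
rewrite orbit_eq -[X in same_orbit X]class_reprK -[X in same_orbit _ X]class_reprK.
rewrite same_orbit_rho; split=> [[]//|e].
exact: eq_exist.
Qed.

End Kappa.

Theorem theorem4p24 (C : strict_rigid) :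
  exists kappa : PicA C -> Piv C,
    [/\ forall (A : invA C) (X : drinfeld_centre C),
          piv_component (kappa (picA_class A)) X = rho A X,
        heap_morphism kappa
      & exists! iota : PicA_mod_PicSZ C -> Piv C,
          [/\ heap_morphism iota,
              injective iota
            & iota \o @orbit_projection C = kappa]].
Proof.
exists (@kappa C); split; [exact: kappaE|exact: kappa_morphism|].
pose iota (u : PicA_mod_PicSZ C) : Piv C := kappa (class_repr u).
have iotaE a : iota (orbit_projection a) = kappa a.
  by apply/kappa_eq; exact: class_reprK.
have projK (u : PicA_mod_PicSZ C) : u = orbit_projection (class_repr u).
  by symmetry; exact: class_reprK.
exists iota; split; first split.
- move=> u v w; rewrite (projK u) (projK v) (projK w).
  by rewrite -orbit_projection_morphism !iotaE kappa_morphism.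
- by move=> u v /kappa_eq e; rewrite (projK u) (projK v).
- exact: funext.
(* Uniqueness: every orbit is the projection of its representative. *)
- move=> j [_ _ e]; apply: funext => u.
  by rewrite (projK u) iotaE -e.
Qed.
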